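(* Let $p$ be an odd prime. The Hausdorff spectrum of the pro-$p$ group $W=C_p\mathrel{\hat{\wr}}\mathbb{Z}_p$ with respect to the lower $p$-series $\mathcal{L}$ is \[ \mathrm{hspec}^{\mathcal{L}}(W)=[0,\tfrac12]\cup\Big\{\tfrac12+\tfrac{m}{2p^n}\;\Big|\; n\in\mathbb{N}_0,\ 1\le m\le p^n-1\Big\}\cup\{1\}. \] Furthermore, every closed subgroup $K\le W$ with $\mathrm{hdim}^{\mathcal{L}}_W(K)>\tfrac12$ has strong Hausdorff dimension in $W$ with respect to $\mathcal{L}$.
   Context: $W=C_p\mathrel{\hat{\wr}}\mathbb{Z}_p=\varprojlim_k C_p\wr C_{p^k}$ is the inverse limit of the standard wreath products of cyclic groups with respect to the natural projections. The lower $p$-series $\mathcal{L}$ of a finitely generated pro-$p$ group $\Gamma$ is $P_1(\Gamma)=\Gamma$, $P_i(\Gamma)=P_{i-1}(\Gamma)^p[P_{i-1}(\Gamma),\Gamma]$ for $i\ge2$ (closed subgroups). For a closed subgroup $K\le W$, $\mathrm{hdim}^{\mathcal{L}}_W(K)=\liminf_{i\to\infty}\frac{\log_p|KP_i(W):P_i(W)|}{\log_p|W:P_i(W)|}$, and $\mathrm{hspec}^{\mathcal{L}}(W)=\{\mathrm{hdim}^{\mathcal{L}}_W(K)\mid K\text{ a closed subgroup of }W\}$. One says that $K$ has strong Hausdorff dimension in $W$ with respect to $\mathcal{L}$ if this lower limit is a proper limit. *)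

(* Defs.v *)
From HB Require Import structures.
From mathcomp Require Import all_boot all_order all_algebra.
From mathcomp Require Import finmap.
From mathcomp Require Import all_classical all_reals all_analysis.
Set Implicit Arguments.
Unset Strict Implicit.
Unset Printing Implicit Defensive.
Import Order.TTheory GRing.Theory Num.Theory.
Import numFieldNormedType.Exports.
Local Open Scope classical_set_scope.
Local Open Scope ring_scope.

HB.structure Definition PreTopologicalGroup := {G of Topological G & monoid.Group G}.

HB.mixin Record PreTopologicalGroup_isTopologicalGroup G
    of PreTopologicalGroup G := {
  mulg_continuous : continuous (fun z : G * G => (z.1 * z.2)%g);
  invg_continuous : continuous (fun x : G => (x^-1)%g)
}.

#[short(type="topologicalGroupType")]
HB.structure Definition TopologicalGroup :=
  {G of PreTopologicalGroup G & PreTopologicalGroup_isTopologicalGroup G}.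

Section TopologicalGroups.
Variable G : topologicalGroupType.
Implicit Types (x y : G) (A H P : set G).

Definition subgroup H : Prop :=
  [/\ H 1%g, forall x y, H x -> H y -> H (x * y)%g
    & forall x, H x -> H (x^-1)%g].

Definition closed_subgroup H : Prop := subgroup H /\ closed H.

(* the closed subgroup (topologically) generated by A *)
Definition closed_gen A : set G := smallest closed_subgroup A.

(* H^p [H, G] *)
Definition lower_p_step (p : nat) (H : set G) : set G :=
  closed_gen ([set (x ^+ p)%g | x in H] `|`
              [set z | exists x y, H x /\ z = [~ x, y]%g]).

(* Numbered from 1: [lower_p_series G p 1] is the whole group; so is the
   irrelevant term of index 0. *)
Definition lower_p_series (p i : nat) : set G :=
  iter i.-1 (lower_p_step p) setT.

Definition set_mulg A P : set G := [set (a * b)%g | a in A & b in P].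

(* The number |H : P| of cosets hP with h in H; [fset_set] makes it 0 when
   there are infinitely many. *)
Definition coset_index H P : nat :=
  #|` fset_set [set [set (h * x)%g | x in P] | h in H]|%fset.

End TopologicalGroups.

Arguments lower_p_series G p i : clear implicits.

Section HausdorffDimension.
Variables (R : realType) (G : topologicalGroupType).
Implicit Types K : set G.

Definition log_nat (p n : nat) : R := ln n%:R / ln p%:R.

(* At i = 1 the denominator vanishes and the quotient is 0. *)
Definition hdim_quotient (p : nat) K (i : nat) : R :=
  let P := lower_p_series G p i in
  log_nat p (coset_index (set_mulg K P) P) / log_nat p (coset_index [set: G] P).

Definition hdim (p : nat) K : R := limn_inf (hdim_quotient p K).

Definition hspec (p : nat) : set R := hdim p @` @closed_subgroup G.

Definition strong_hdim (p : nat) K : Prop :=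
  hdim_quotient p K @ \oo --> hdim p K.

End HausdorffDimension.

Arguments hspec R G p : clear implicits.

(* The standard (regular) wreath product of additively written abelian groups:
   (f, b) stands for the product of f in the base group A^B and b in B, and
   b acts on the base group by translation. *)
Definition wreath (A B : finZmodType) : Type := ({ffun B -> A} * B)%type.

Section Wreath.
Variables A B : finZmodType.
Implicit Types u v w : wreath A B.

HB.instance Definition _ := Choice.copy (wreath A B) ({ffun B -> A} * B)%type.

Definition wreath_one : wreath A B := ([ffun=> 0], 0).
Definition wreath_inv u : wreath A B := ([ffun x => - u.1 (x + u.2)], - u.2).
Definition wreath_mul u v : wreath A B :=
  ([ffun x => u.1 x + v.1 (x - u.2)], u.2 + v.2).

Lemma wreath_mulA : associative wreath_mul.
Proof.
move=> u v w; congr pair; last exact: addrA.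
by apply/ffunP => x; rewrite !ffunE /= addrA opprD addrA.
Qed.

Lemma wreath_mul1 : left_id wreath_one wreath_mul.
Proof.
case=> f b; congr pair; last exact: add0r.
by apply/ffunP => x; rewrite !ffunE /= add0r subr0.
Qed.

Lemma wreath_mulr1 : right_id wreath_one wreath_mul.
Proof.
case=> f b; congr pair; last exact: addr0.
by apply/ffunP => x; rewrite !ffunE /= addr0.
Qed.

Lemma wreath_mulV : left_inverse wreath_one wreath_inv wreath_mul.
Proof.
case=> f b; congr pair; last exact: addNr.
by apply/ffunP => x; rewrite !ffunE /= opprK addNr.
Qed.

Lemma wreath_mulrV : right_inverse wreath_one wreath_inv wreath_mul.
Proof.
case=> f b; congr pair; last exact: subrr.
by apply/ffunP => x; rewrite !ffunE /= subrK subrr.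
Qed.

HB.instance Definition _ := isGroup.Build (wreath A B)
  wreath_mulA wreath_mul1 wreath_mulr1 wreath_mulV wreath_mulrV.

End Wreath.

(* The map of wreath products induced by pi : B -> B'; on base groups it is the
   map of group algebras A[B] -> A[B'], which sums along the fibres of pi. *)
Definition wreath_map (A B B' : finZmodType) (pi : B -> B') (u : wreath A B) :
    wreath A B' :=
  ([ffun y => \sum_(x | pi x == y) u.1 x], pi u.2).

Lemma wreath_mapM (A B B' : finZmodType) (pi : {additive B -> B'}) :
  {morph wreath_map (A := A) pi : u v / (u * v)%g}.
Proof.
move=> u v; congr pair; last exact: raddfD.
apply/ffunP => y; rewrite !ffunE.
under eq_bigr do rewrite ffunE.
rewrite big_split /=; congr (_ + _).
rewrite (reindex_inj (addIr u.2)) /=; apply: eq_big => [x|x _].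
  by rewrite raddfD [RHS]eq_sym subr_eq eq_sym.
by rewrite addrK.
Qed.

Lemma wreath_map1 (A B B' : finZmodType) (pi : {additive B -> B'}) :
  wreath_map pi (1%g : wreath A B) = 1%g.
Proof.
congr pair; last exact: raddf0.
by apply/ffunP => y; rewrite !ffunE big1 // => x _; rewrite ffunE.
Qed.

HB.instance Definition _ (A B B' : finZmodType) (pi : {additive B -> B'}) :=
  monoid.isUMagmaMorphism.Build (wreath A B) (wreath A B')
    (wreath_map (A := A) pi) (wreath_map1 A pi, @wreath_mapM A B B' pi).

(* Z/n, additively; unlike 'Z_n it is the trivial group for n = 1. *)
Definition cyc (n : nat) : finZmodType := 'I_n.-1.+1.

(* the natural projection Z/n -> Z/m, meaningful when m divides n *)
Definition cyc_proj (n m : nat) (x : cyc n) : cyc m := inZp (val x).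

Lemma cyc_proj_additive (p k : nat) :
  nmod_morphism (@cyc_proj (p ^ k.+1) (p ^ k)).
Proof.
have dvd_pk : ((p ^ k).-1.+1 %| (p ^ k.+1).-1.+1)%N.
  case: (posnP p) => [->|p_gt0]; first by case: k => [|k] //; rewrite !exp0n.
  by rewrite !prednK ?expn_gt0 ?p_gt0 // expnS dvdn_mull.
split=> [|x y]; apply: val_inj => /=; first by rewrite mod0n.
by rewrite modn_dvdm // modnDm.
Qed.

HB.instance Definition _ (p k : nat) := GRing.isNmodMorphism.Build
  (cyc (p ^ k.+1)) (cyc (p ^ k)) (@cyc_proj (p ^ k.+1) (p ^ k))
  (cyc_proj_additive p k).

Section InverseLimit.
Variables (G : nat -> groupType).
Variable pi : forall k, monoid.UMagmaMorphism.type (G k.+1) (G k).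

(* lim G k along the maps pi k : G k.+1 -> G k *)
Record invlim : Type := InvLim {
  thread :> forall k, G k;
  threadP : forall k, pi k (thread k.+1) = thread k }.

Lemma thread_inj (x y : invlim) : (forall k, x k = y k) -> x = y.
Proof.
move=> xy; have {xy} := functional_extensionality_dep xy.
case: x y => [x Px] [y Py] /= xy; rewrite -{y}xy in Py *.
by congr InvLim; exact: Prop_irrelevance.
Qed.

HB.instance Definition _ := gen_eqMixin invlim.
HB.instance Definition _ := gen_choiceMixin invlim.

Definition invlim_one : invlim :=
  @InvLim (fun k => 1%g) (fun k => gmulf1).

Lemma invlim_invP (x : invlim) k : pi k (x k.+1)^-1%g = (x k)^-1%g.
Proof. by rewrite gmulfV threadP. Qed.
Definition invlim_inv x : invlim := InvLim (invlim_invP x).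

Lemma invlim_mulP (x y : invlim) k : pi k (x k.+1 * y k.+1)%g = (x k * y k)%g.
Proof. by rewrite gmulfM !threadP. Qed.
Definition invlim_mul x y : invlim := InvLim (invlim_mulP x y).

Lemma invlim_mulA : associative invlim_mul.
Proof. by move=> x y z; apply: thread_inj => k; exact: mulgA. Qed.
Lemma invlim_mul1 : left_id invlim_one invlim_mul.
Proof. by move=> x; apply: thread_inj => k; exact: mul1g. Qed.
Lemma invlim_mulr1 : right_id invlim_one invlim_mul.
Proof. by move=> x; apply: thread_inj => k; exact: mulg1. Qed.
Lemma invlim_mulV : left_inverse invlim_one invlim_inv invlim_mul.
Proof. by move=> x; apply: thread_inj => k; exact: mulVg. Qed.
Lemma invlim_mulrV : right_inverse invlim_one invlim_inv invlim_mul.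
Proof. by move=> x; apply: thread_inj => k; exact: mulgV. Qed.

HB.instance Definition _ := isGroup.Build invlim
  invlim_mulA invlim_mul1 invlim_mulr1 invlim_mulV invlim_mulrV.

(* the subspace topology from the product of the discrete G k *)
HB.instance Definition _ := Topological.copy invlim
  (initial_topology
    (thread : invlim -> prod_topology (fun k => discrete_topology (G k)))).

Lemma continuous_invlim (X : topologicalType) (f : X -> invlim) :
  (forall k, continuous (fun x => f x k : discrete_topology (G k))) ->
  continuous f.
Proof.
move=> fc; apply: continuous_comp_initial => x.
apply/cvg_sup => k; move: x; apply: continuous_comp_initial; exact: fc.
Qed.

Lemma thread_continuous k :
  continuous (fun x : invlim => x k : discrete_topology (G k)).
Proof.
pose T k := discrete_topology (G k).
have c : continuous (thread : invlim -> prod_topology T).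
  exact: initial_continuous.
move=> x; exact: (cvg_comp _ _ (c x) (@proj_continuous _ T k (thread x))).
Qed.

Lemma near_thread (x : invlim) k : nbhs x [set y : invlim | y k = x k].
Proof.
have := @thread_continuous k x [set x k].
by apply; exact: (@discrete_set1 (discrete_topology (G k))).
Qed.

Lemma invlim_mul_continuous :
  continuous (fun z : invlim * invlim => (z.1 * z.2)%g).
Proof.
apply: continuous_invlim => k -[x y]; apply/discrete_cvg.
exists ([set a : invlim | a k = x k], [set b : invlim | b k = y k]).
  by split; exact: near_thread.
by move=> -[a b] [/= ak bk]; rewrite /= ak bk.
Qed.

Lemma invlim_inv_continuous : continuous (fun x : invlim => (x^-1)%g).
Proof.
apply: continuous_invlim => k x A /nbhs_singleton Ax.
have sub : [set y : invlim | y k = x k] `<=`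
    [set y : invlim | A (y k)^-1%g] by move=> y /= ->.
exact: (filterS sub (near_thread x k)).
Qed.

HB.instance Definition _ := PreTopologicalGroup_isTopologicalGroup.Build invlim
  invlim_mul_continuous invlim_inv_continuous.

End InverseLimit.

(* C_p wr C_(p^k), with C_p the additive group of 'F_p, so p must be prime *)
Definition wreath_pk (p k : nat) : groupType := wreath 'F_p (cyc (p ^ k)).

Definition wreath_pk_proj (p k : nat) :
    monoid.UMagmaMorphism.type (wreath_pk p k.+1) (wreath_pk p k) :=
  wreath_map (A := 'F_p) (@cyc_proj (p ^ k.+1) (p ^ k)).

(* the pro-p group C_p ^wr Z_p *)
Definition W (p : nat) : topologicalGroupType := invlim (wreath_pk_proj p).

(* Main.v *)
(* Write W = F_p[[t]] x| Z_p, a generator of Z_p acting as multiplication by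
   1 + t.  Then P_(k+1)(W) = t^k F_p[[t]] x| p^k Z_p.  For a subgroup K, the index
   |K P_(k+1) : P_(k+1)| is p to the number of jumps of K along the filtration of
   W that first reduces the Z_p part to p^k Z_p and then the power series part to
   t^k F_p[[t]].  If K lies in the base group there are at most k jumps, so its
   dimension is at most 1/2.  Otherwise let p^n Z_p be the image of K in Z_p: it
   contributes k - n jumps, and the t-adic valuations of the elements of K with
   Z_p part in p^k Z_p contribute the rest.  For k > n, multiplying by powers of
   y^(p^(k-n)), where y in K has Z_p part of valuation n, shows that these
   valuations below k do not depend on k, and taking commutators with y shifts
   them by p^n.  They hence fill up, from some point on, m residue classes modulo
   p^n, and the dimension is the limit 1/2 + m/(2p^n). *)
Require Import Defs.
From mathcomp Require Import all_boot all_order all_algebra.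
From mathcomp Require Import finmap.
From mathcomp Require Import all_classical all_reals all_analysis.
From mathcomp Require Import ring lra zify.
Set Implicit Arguments.
Unset Strict Implicit.
Unset Printing Implicit Defensive.
Import Order.TTheory GRing.Theory Num.Theory.
Import numFieldNormedType.Exports.
Local Open Scope classical_set_scope.
Local Open Scope ring_scope.

(** * Group algebras of cyclic groups in characteristic p *)

Lemma dvdp_XnP (F : fieldType) n (q : {poly F}) :
  reflect (forall i, (i < n)%N -> q`_i = 0) ('X^n %| q).
Proof.
apply: (iffP idP) => [/dvdpP[r ->] i ltin|q0]; first by rewrite coefMXn ltin.
apply/dvdpP; exists (drop_poly n q).
rewrite -[LHS](poly_take_drop n) [take_poly n q](_ : _ = 0) ?add0r //.
by apply/polyP => i; rewrite coef_take_poly coef0; case: ltnP => // /q0.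
Qed.

Lemma dvdp_subrX_modn (F : fieldType) (u : {poly F}) N m :
  u ^+ N - 1 %| u ^+ m - u ^+ (m %% N).
Proof.
rewrite {1}(divn_eq m N) addnC exprD -{2}[u ^+ (m %% N)]mulr1 -mulrBr.
by rewrite dvdp_mull // mulnC exprM [X in _ %| X]subrX1 dvdp_mulr.
Qed.

Section CyclicGroupAlgebra.
Variable F : fieldType.

(* The element of F[C_N] written in powers of t = x - 1, with x the generator. *)
Definition cyc_poly N (f : {ffun 'I_N -> F}) : {poly F} :=
  \sum_(j < N) f j *: ('X + 1) ^+ j.

Lemma cyc_polyE N (f : {ffun 'I_N -> F}) :
  cyc_poly f = (\sum_(j < N) f j *: 'X^j) \Po ('X + 1).
Proof.
rewrite raddf_sum; apply: eq_bigr => j _ /=.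
by rewrite comp_polyZ rmorphXn /= comp_polyX.
Qed.

Lemma size_cyc_poly N (f : {ffun 'I_N -> F}) : (size (cyc_poly f) <= N)%N.
Proof.
rewrite cyc_polyE size_comp_poly2 ?size_XaddC //.
apply: (leq_trans (size_sum _ _ _)); apply/bigmax_leqP => j _.
by apply: (leq_trans (size_scale_leq _ _)); rewrite size_polyXn.
Qed.

Lemma cyc_polyD N (f g : {ffun 'I_N -> F}) :
  cyc_poly [ffun x => f x + g x] = cyc_poly f + cyc_poly g.
Proof.
by rewrite -big_split; apply: eq_bigr => j _; rewrite ffunE scalerDl.
Qed.

Lemma comp_polyXD1K : cancel (comp_poly ('X + 1 : {poly F})) (comp_poly ('X - 1)).
Proof.
move=> q; rewrite -comp_polyA comp_polyD comp_polyX comp_polyC subrK.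
exact: comp_polyXr.
Qed.

Lemma comp_polyXB1K : cancel (comp_poly ('X - 1 : {poly F})) (comp_poly ('X + 1)).
Proof.
move=> q; rewrite -comp_polyA comp_polyB comp_polyX comp_polyC addrK.
exact: comp_polyXr.
Qed.

Lemma cyc_poly_inj N : injective (@cyc_poly N).
Proof.
move=> f g; rewrite !cyc_polyE => /(can_inj comp_polyXD1K) /polyP fg.
have coefj (h : {ffun 'I_N -> F}) (j : 'I_N) :
    (\sum_(i < N) h i *: 'X^i)`_j = h j.
  rewrite coef_sum (bigD1 j) //= coefZ coefXn eqxx mulr1 big1 ?addr0 // => i.
  by rewrite coefZ coefXn eq_sym -val_eqE /= => /negPf->; rewrite mulr0.
by apply/ffunP => j; rewrite -coefj fg coefj.
Qed.

(** The inverse of [cyc_poly] on polynomials of size at most N: substituting ['X - 1] turns powers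
    of t back into powers of the generator. *)
Definition poly_cyc N (q : {poly F}) : {ffun 'I_N -> F} :=
  [ffun j => (q \Po ('X - 1))`_(nat_of_ord j)].

Lemma poly_cycK N (q : {poly F}) : (size q <= N)%N -> cyc_poly (poly_cyc N q) = q.
Proof.
move=> le_qN; rewrite cyc_polyE -[RHS]comp_polyXB1K; congr (_ \Po _).
have le_q'N : (size (q \Po ('X - 1)) <= N)%N by rewrite size_comp_poly2 ?size_XsubC.
under eq_bigr do rewrite ffunE.
rewrite -(poly_def _ (fun i => (q \Po ('X - 1))`_i)); apply/polyP => i.
by rewrite coef_poly; case: ltnP => // le_Ni; rewrite nth_default ?(leq_trans le_q'N).
Qed.

(* N is written n.+1 because only 'I_n.+1 is canonically a group. *)
Lemma cyc_poly_shift n (f : {ffun 'I_n.+1 -> F}) (b : 'I_n.+1) :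
  ('X + 1) ^+ n.+1 - 1 %|
    cyc_poly [ffun x => f (x - b)] - ('X + 1) ^+ b * cyc_poly f.
Proof.
rewrite /cyc_poly (reindex_inj (addIr b)) mulr_sumr -sumrB.
apply: (big_ind (fun q => _ %| q)) => [|q r|j _]; [exact: dvdp0 | exact: dvdp_add |].
rewrite ffunE addrK -scalerAr -scalerBr /= -exprD addnC.
by rewrite -mul_polyC dvdp_mull // -dvdpNr opprB dvdp_subrX_modn.
Qed.
End CyclicGroupAlgebra.

(** * Coordinates on W *)

Section Coordinates.
Variables (p : nat) (p_prime : prime p).
Local Notation Fp := 'F_p.
Implicit Types (x y z w : W p) (q r : {poly Fp}).

(* For x = (f, b) in F_p[[t]] x| Z_p, [zpart x k] is b mod p^k, [base x k]
   represents f mod t^(p^k), and [tcoef x a] is the coefficient of t^a in f. *)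
Definition zpart x k : nat := nat_of_ord (thread x k).2.
Definition base x k : {poly Fp} :=
  @cyc_poly Fp (p ^ k).-1.+1 (thread x k).1.
Definition tcoef x a : Fp := (base x a)`_a.

Let p_gt0 : (0 < p)%N := prime_gt0 p_prime.
Let pk_gt0 k : (0 < p ^ k)%N. Proof. by rewrite expn_gt0 p_gt0. Qed.

Let modn_pk m k : (m %% (p ^ k).-1.+1)%N = (m %% p ^ k)%N.
Proof. by rewrite prednK. Qed.

(** Frobenius. With x = 1 + t the relation x^(p^k) = 1 becomes t^(p^k) = 0, which identifies
    F_p[C_(p^k)] with F_p[t]/(t^(p^k)). *)
Lemma polyXD1_expp k : ('X + 1 : {poly Fp}) ^+ (p ^ k) = 'X^(p ^ k) + 1.
Proof.
rewrite exprDn_pchar ?expr1n // pnatX; apply/orP; left.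
by rewrite pnatE // pchar_lalg pchar_Fp.
Qed.

Lemma zpart_lt x k : (zpart x k < p ^ k)%N.
Proof. by rewrite -[X in (_ < X)%N]prednK // ltn_ord. Qed.

Lemma zpart_modS x k : (zpart x k.+1 %% p ^ k)%N = zpart x k.
Proof.
by rewrite /zpart -[in RHS](threadP x k) /=; exact/esym/modn_pk.
Qed.

Lemma zpart_mod x j k : (j <= k)%N -> (zpart x k %% p ^ j)%N = zpart x j.
Proof.
move=> /subnK <-; elim: (k - j)%N => [|i IHi]; first by rewrite modn_small ?zpart_lt.
by rewrite addSn -IHi -(zpart_modS x (i + j)) modn_dvdm // dvdn_exp2l // leq_addl.
Qed.

Lemma zpart0 x : zpart x 0 = 0%N.
Proof. by have := zpart_lt x 0; rewrite expn0 ltnS leqn0 => /eqP. Qed.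

Lemma zpartM x y k : zpart (x * y)%g k = ((zpart x k + zpart y k) %% p ^ k)%N.
Proof. exact: modn_pk. Qed.

Lemma zpart1 k : zpart 1%g k = 0%N.
Proof. by []. Qed.

Lemma base1 k : base 1%g k = 0.
Proof. by rewrite /base /cyc_poly big1 // => j _; rewrite ffunE scale0r. Qed.

Lemma tcoef1 a : tcoef 1%g a = 0.
Proof. by rewrite /tcoef base1 coef0. Qed.

(** The product rule (f, b)(g, c) = (f + (1 + t)^b g, b + c), read modulo t^(p^k): translation by b
    is multiplication by (1 + t)^b. *)
Lemma baseM x y k :
  'X^(p ^ k) %| base (x * y)%g k - (base x k + ('X + 1) ^+ zpart x k * base y k).
Proof.
pose g : {ffun 'I_(p ^ k).-1.+1 -> Fp} := (thread y k).1.
pose b : 'I_(p ^ k).-1.+1 := (thread x k).2.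
have -> : base (x * y)%g k = base x k + cyc_poly [ffun i => g (i - b)].
  by rewrite /base -cyc_polyD; congr cyc_poly; apply/ffunP => i; rewrite !ffunE.
rewrite opprD addrACA subrr add0r.
rewrite -[X in X %| _](addrK 1) -polyXD1_expp.
by rewrite -[X in _ ^+ X - 1]prednK // cyc_poly_shift.
Qed.

(** Summing along fibres sends x^j to x^(j mod p^k), which changes it by a multiple of x^(p^k) - 1 =
    t^(p^k). So the natural projection truncates power series. *)
Lemma cyc_poly_proj k (u : wreath_pk p k.+1) :
  'X^(p ^ k) %|
    @cyc_poly Fp (p ^ k.+1).-1.+1 u.1 -
    @cyc_poly Fp (p ^ k).-1.+1 (wreath_pk_proj p k u).1.
Proof.
rewrite /= /cyc_poly.
under [X in _ - X]eq_bigr do rewrite ffunE scaler_suml.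
rewrite [X in _ - X](exchange_big_dep predT) //= -sumrB.
apply: (big_ind (fun q => _ %| q)) => [|q r|j _]; [exact: dvdp0|exact: dvdp_add|].
rewrite (big_pred1 (@cyc_proj (p ^ k.+1) (p ^ k) j)) => [|i]; last by rewrite eq_sym.
rewrite -scalerBr -mul_polyC dvdp_mull //= modn_pk.
by rewrite -[X in X %| _](addrK 1) -polyXD1_expp dvdp_subrX_modn.
Qed.

Lemma base_stab x k : 'X^(p ^ k) %| base x k.+1 - base x k.
Proof. by rewrite /base -[in X in _ - X](threadP x k) cyc_poly_proj. Qed.

(** By [base_stab] the coefficient of t^a is the same at all levels k with a < p^k; level a, used to
    define [tcoef], is one of them. *)
Lemma tcoefE x k a : (a < p ^ k)%N -> tcoef x a = (base x k)`_a.
Proof.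
have step j : (a < p ^ j)%N -> (base x j.+1)`_a = (base x j)`_a.
  move=> ltaj; have /dvdp_XnP/(_ _ ltaj) := base_stab x j.
  by rewrite coefB => /eqP; rewrite subr_eq0 => /eqP.
have mono i j : (a < p ^ j)%N -> (j <= i)%N -> (base x i)`_a = (base x j)`_a.
  move=> ltaj /subnK <-; elim: (i - j)%N => // n IHn; rewrite addSn step //.
  by rewrite (leq_trans ltaj) // leq_pexp2l // leq_addl.
move=> ltak; rewrite /tcoef; have ltaa : (a < p ^ a)%N by rewrite ltn_expl ?prime_gt1.
by case: (leqP a k) => [le_ak|/ltnW le_ka]; [rewrite (mono k a) | rewrite (mono a k)].
Qed.

Lemma dvd_base x k n : (n <= p ^ k)%N ->
  'X^n %| base x k <-> (forall a, (a < n)%N -> tcoef x a = 0).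
Proof.
move=> le_nk; split=> [/dvdp_XnP dvd a ltan|c0].
  by rewrite (@tcoefE _ k) ?dvd // (leq_trans ltan).
by apply/dvdp_XnP => a ltan; rewrite -(@tcoefE _ k) ?c0 // (leq_trans ltan).
Qed.

Lemma coord_inj x y : zpart x =1 zpart y -> tcoef x =1 tcoef y -> x = y.
Proof.
move=> zxy cxy; apply: thread_inj => k.
rewrite [LHS]surjective_pairing [RHS]surjective_pairing; congr pair; last first.
  exact/val_inj/zxy.
apply: (@cyc_poly_inj Fp (p ^ k).-1.+1); apply/polyP => a.
have [ltak|leka] := ltnP a (p ^ k).
  by rewrite -[LHS](tcoefE x ltak) -[RHS](tcoefE y ltak).
by rewrite !nth_default // (leq_trans _ leka) // -[X in (_ <= X)%N]prednK ?size_cyc_poly.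
Qed.

(** With [coord_inj], this makes W the set F_p[[t]] x Z_p: the thread through given coordinates
    consists of the truncations of f at t^(p^k). *)
Lemma coord_surj (f : nat -> Fp) (b : nat -> nat) :
    (forall k, b k < p ^ k)%N -> (forall k, b k.+1 %% p ^ k = b k)%N ->
  exists x, zpart x =1 b /\ tcoef x =1 f.
Proof.
move=> b_lt b_mod.
have sz k : (size (\poly_(a < p ^ k) f a) <= (p ^ k).-1.+1)%N.
  by rewrite prednK ?size_poly.
have bval k : nat_of_ord (inord (b k) : 'I_(p ^ k).-1.+1) = b k.
  by rewrite inordK // prednK.
pose u k : wreath_pk p k :=
  (poly_cyc (p ^ k).-1.+1 (\poly_(a < p ^ k) f a), inord (b k)).
have uP k : wreath_pk_proj p k (u k.+1) = u k.
  congr pair; last first.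
    apply: val_inj; rewrite /= !bval; exact: etrans (modn_pk _ _) (b_mod k).
  apply: (@cyc_poly_inj Fp (p ^ k).-1.+1).
  apply/eqP; rewrite -subr_eq0; apply/eqP/polyP => a; rewrite coef0 /= poly_cycK //.
  have [ltak|leka] := ltnP a (p ^ k); last first.
    rewrite nth_default // (leq_trans _ leka) // (leq_trans (size_polyD _ _)) //.
    rewrite geq_max size_polyN size_poly andbT.
    by rewrite -[X in (_ <= X)%N](prednK (pk_gt0 k)) size_cyc_poly.
  have /dvdp_XnP/(_ _ ltak) := cyc_poly_proj (u k.+1).
  rewrite /= poly_cycK // !coefB !coef_poly ltak.
  rewrite (leq_trans ltak) ?leq_exp2l ?prime_gt1 //.
  by move=> /eqP; rewrite subr_eq0 => /eqP->; rewrite subrr.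
exists (InvLim uP); split=> [k|a].
  exact: bval.
rewrite /tcoef /base /= poly_cycK // coef_poly.
by rewrite ltn_expl // prime_gt1.
Qed.
End Coordinates.

(** * Multiplication in coordinates *)

Lemma coef_mul_lead (F : fieldType) n (q r : {poly F}) :
  'X^n %| q -> (r * q)`_n = r`_0 * q`_n.
Proof.
by case/dvdpP => s ->; rewrite mulrA !coefMXn ltnn subnn coef0M.
Qed.

(* In characteristic p, (u^m - 1)/(u - 1) = (u - 1)^(m - 1) for m = p^j. *)
Lemma sum_expr_pchar (F : fieldType) (p j : nat) (u : {poly F}) :
  p \in [pchar F] -> \sum_(i < p ^ j) u ^+ i = (u - 1) ^+ (p ^ j - 1).
Proof.
move=> pF; have p_gt0 := prime_gt0 (pcharf_prime pF).
have pP : p \in [pchar {poly F}] by rewrite pchar_lalg.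
have pnat : [pchar {poly F}].-nat (p ^ j)%N.
  by rewrite pnatX pnatE ?(pcharf_prime pF) // pP.
have pj_gt0 : (0 < p ^ j)%N by rewrite expn_gt0 p_gt0.
(* One cannot cancel u - 1 when u = 1. There the sum is p^j, which is 0 unless j = 0, and for j = 0
   the right side is 0^0 = 1. *)
have [->|u1] := eqVneq u 1.
  rewrite (eq_bigr (fun=> 1)) => [|i _]; last by rewrite expr1n.
  rewrite subrr sumr_const card_ord expr0n subn_eq0 leq_eqVlt ltnNge pj_gt0 orbF.
  case: j {pnat pj_gt0} => [|j]; first by rewrite expn0 eqxx.
  rewrite natrX (pcharf0 pP) expr0n /= -[1%N]/(p ^ 0)%N eqn_exp2l //.
  exact: prime_gt1 (pcharf_prime pF).
apply: (mulfI (_ : u - 1 != 0)); first by rewrite subr_eq0.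
by rewrite -subrX1 -exprS subn1 prednK // -{1}(subrK 1 u) exprDn_pchar // expr1n addrK.
Qed.

Section Group.
Variables (p : nat) (p_prime : prime p).
Local Notation Fp := 'F_p.
Implicit Types (x y z w : W p) (q r : {poly Fp}).

(** The factor by which x acts on the base group, at level k. *)
Definition twist x k : {poly Fp} := ('X + 1) ^+ zpart x k.

Let p_gt0 : (0 < p)%N := prime_gt0 p_prime.
Let p_gt1 : (1 < p)%N := prime_gt1 p_prime.
Let pk_gt0 k : (0 < p ^ k)%N. Proof. by rewrite expn_gt0 p_gt0. Qed.

Lemma coef0_twist x k : (twist x k)`_0 = 1.
Proof. by rewrite -horner_coef0 /twist !hornerE expr1n. Qed.

Lemma zpart_dvd x n k : (n <= k)%N -> (p ^ n %| zpart x k)%N = (zpart x n == 0%N).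
Proof. by move=> le_nk; rewrite /dvdn zpart_mod. Qed.

Lemma zpart_anti x n k : (n <= k)%N -> zpart x k = 0%N -> zpart x n = 0%N.
Proof. by move=> le_nk xk; rewrite -(zpart_mod p_prime x le_nk) xk mod0n. Qed.

(** If the Z_p part is p^n u, then (1 + t)^(p^n u) - 1 = (1 + t^(p^n))^u - 1, a geometric sum of u
    terms times t^(p^n); each term has constant coefficient 1. *)
Lemma twist_sub1 x n k : (n <= k)%N -> zpart x n = 0%N ->
  exists2 r, twist x k - 1 = r * 'X^(p ^ n) & r`_0 = (zpart x k %/ p ^ n)%:R.
Proof.
move=> le_nk xn0; set u := (_ %/ _)%N.
have xk : zpart x k = (p ^ n * u)%N by rewrite mulnC divnK ?zpart_dvd ?xn0.
exists (\sum_(i < u) ('X^(p ^ n) + 1) ^+ i).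
  by rewrite /twist xk exprM polyXD1_expp // subrX1 addrK mulrC.
rewrite coef_sum (eq_bigr (fun=> 1)) ?sumr_const ?card_ord // => i _.
by rewrite -horner_coef0 !hornerE expr0n gtn_eqF // add0r expr1n.
Qed.

Lemma dvd_twist_sub1 x n k : (n <= k)%N -> zpart x n = 0%N ->
  'X^(p ^ n) %| twist x k - 1.
Proof. by move=> le_nk /(twist_sub1 le_nk)[r -> _]; rewrite dvdp_mull. Qed.

Lemma dvdX_twist_sub1 x k : 'X %| twist x k - 1.
Proof.
by have := dvd_twist_sub1 (leq0n k) (zpart0 p_prime x); rewrite expn0 expr1.
Qed.

Lemma coprimep_twist x k n : coprimep 'X^n (twist x k).
Proof.
rewrite coprimep_expl // coprimep_sym coprimepX.
by rewrite /root horner_coef0 coef0_twist oner_eq0.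
Qed.

Lemma zpartX x m k : zpart (x ^+ m)%g k = ((m * zpart x k) %% p ^ k)%N.
Proof.
elim: m => [|m IHm]; first by rewrite expg0 zpart1 mul0n mod0n.
by rewrite expgS zpartM // IHm modnDmr mulSn.
Qed.

Lemma baseX x m k :
  'X^(p ^ k) %| base (x ^+ m)%g k - base x k * \sum_(i < m) twist x k ^+ i.
Proof.
elim: m => [|m IHm]; first by rewrite expg0 base1 big_ord0 mulr0 subrr dvdp0.
rewrite expgS big_ord_recl expr0.
under eq_bigr do rewrite exprS.
rewrite -mulr_sumr; set S := \sum_(i < m) _ in IHm *.
have := dvdp_add (baseM p_prime x (x ^+ m)%g k) (dvdp_mull (twist x k) IHm).
congr (_ %| _); rewrite /twist; ring.
Qed.

(** Compare the base parts of the two sides of xy = yx[x, y]. The factor [twist (y * x)%g k] stays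
    on the left; having constant term 1, it can be cancelled from divisibilities by powers of t. *)
Lemma base_comm x y k :
  'X^(p ^ k) %| twist (y * x)%g k * base [~ x, y]%g k -
    ((1 - twist y k) * base x k + (twist x k - 1) * base y k).
Proof.
have xyE : (x * y)%g = (y * x * [~ x, y])%g by exact: commgC.
have d1 := baseM p_prime x y k; have d2 := baseM p_prime y x k.
have d3 := baseM p_prime (y * x)%g [~ x, y]%g k.
have := dvdp_sub (dvdp_sub d1 d2) d3.
rewrite -xyE; congr (_ %| _); rewrite -!/(twist _ _); ring.
Qed.

Lemma zpart_comm x y k : zpart [~ x, y]%g k = 0%N.
Proof.
have xyE : (x * y)%g = (y * x * [~ x, y])%g by exact: commgC.
move: [~ x, y]%g xyE => w xyE; have := congr1 (fun z => zpart z k) xyE.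
rewrite !zpartM // modnDml => /eqP; rewrite [(zpart y k + _)%N]addnC.
rewrite -{1}[(_ + _)%N]addn0 eqn_modDl mod0n modn_small ?zpart_lt // eq_sym.
by move=> /eqP.
Qed.

(** The action of x has constant term 1, so it fixes the leading coefficient of z. *)
Lemma tcoefM_lead x z a : (forall j, (j < a)%N -> tcoef z j = 0) ->
  tcoef (x * z)%g a = tcoef x a + tcoef z a.
Proof.
move=> z0; have ltaa : (a < p ^ a)%N by rewrite ltn_expl.
have /dvdp_XnP/(_ _ ltaa) := baseM p_prime x z a.
rewrite coefB coefD coef_mul_lead; last by apply/(dvd_base p_prime); rewrite 1?ltnW.
by rewrite -/(twist x a) coef0_twist mul1r => /eqP; rewrite subr_eq0 => /eqP.
Qed.

Lemma zpart_eq0M x y k : zpart x k = 0%N -> zpart y k = 0%N -> zpart (x * y)%g k = 0%N.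
Proof. by move=> x0 y0; rewrite zpartM // x0 y0 mod0n. Qed.

End Group.

(** * The lower p-series *)

Section LowerSeries.
Variables (p : nat) (p_prime : prime p).
Local Notation Fp := 'F_p.
Implicit Types (x y z w : W p) (q r : {poly Fp}).

Let p_gt0 : (0 < p)%N := prime_gt0 p_prime.
Let p_gt1 : (1 < p)%N := prime_gt1 p_prime.
Let pk_gt0 k : (0 < p ^ k)%N. Proof. by rewrite expn_gt0 p_gt0. Qed.

Lemma closed_thread k (P : set (wreath_pk p k)) :
  closed [set x : W p | P (thread x k)].
Proof.
rewrite -[X in closed X]setCK; apply/open_closedC; rewrite openE => x /= nPx.
by apply: filterS (near_thread x k) => y /= ->.
Qed.

Lemma closed_zpart k : closed [set x : W p | zpart x k = 0%N].
Proof. exact: closed_thread (fun u => nat_of_ord u.2 = 0%N). Qed.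

Lemma closed_tcoef a : closed [set x : W p | tcoef x a = 0].
Proof.
exact: closed_thread (fun u => (@cyc_poly Fp (p ^ a).-1.+1 u.1)`_a = 0).
Qed.

Lemma tcoefV_eq0 n x : (forall a, (a < n)%N -> tcoef x a = 0) ->
  forall a, (a < n)%N -> tcoef x^-1%g a = 0.
Proof.
move=> x0; elim/ltn_ind => a IHa ltan.
have /= := @tcoefM_lead p p_prime x x^-1%g a
  (fun j ltja => IHa j ltja (ltn_trans ltja ltan)).
by rewrite mulgV tcoef1 x0 // add0r => <-.
Qed.

Lemma zpartV_eq0 x k : zpart x k = 0%N -> zpart x^-1%g k = 0%N.
Proof.
move=> x0; have := congr1 (fun w => zpart w k) (mulgV x).
by rewrite zpartM // x0 zpart1 modn_small ?zpart_lt.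
Qed.

Definition lower_term k : set (W p) :=
  [set x : W p | zpart x k = 0%N /\ forall a, (a < k)%N -> tcoef x a = 0].

Lemma lower_term_subgroup k : subgroup (lower_term k).
Proof.
split=> [|x y [x0 xc] [y0 yc]|x [x0 xc]].
- by split=> [|a _]; [exact: zpart1|exact: tcoef1].
- split=> [|a ltak]; first exact: zpart_eq0M.
  rewrite tcoefM_lead // => [|j ltja]; first by rewrite xc // yc // addr0.
  by rewrite yc // (ltn_trans ltja).
- by split; [exact: zpartV_eq0|exact: tcoefV_eq0].
Qed.

Lemma lower_term_closed k : closed (lower_term k).
Proof.
apply: closedI; first exact: closed_zpart.
have -> : (fun x : W p => forall a, (a < k)%N -> tcoef x a = 0) =
    \bigcap_(a in [set a | (a < k)%N]) [set x : W p | tcoef x a = 0] by [].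
by apply: closed_bigI => a _; exact: closed_tcoef.
Qed.

Lemma lower_term_base k x : lower_term k x <-> zpart x k = 0%N /\ 'X^k %| base x k.
Proof.
have lek : (k <= p ^ k)%N by rewrite ltnW // ltn_expl.
split=> -[x0 xk]; split=> //; first exact/(dvd_base p_prime _ lek).
by move/(dvd_base p_prime _ lek): xk.
Qed.

Lemma lower_term_base_succ k x : lower_term k x -> 'X^k %| base x k.+1.
Proof.
case=> _ xc; apply/(dvd_base p_prime) => //.
by rewrite (leq_trans (leqnSn k)) // ltnW // ltn_expl.
Qed.

(** The base part of x^p is f (u - 1)^(p - 1) with u the action of x. As t divides u - 1 and p > 1,
    one more factor t appears. *)
Lemma lower_termX k x : lower_term k x -> lower_term k.+1 (x ^+ p)%g.
Proof.
move=> xk; apply/lower_term_base; split.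
  have : (p ^ k %| zpart x k.+1)%N by rewrite zpart_dvd // xk.1.
  by rewrite zpartX // => /dvdnP[u ->]; rewrite mulnCA -expnS modnMl.
have -> : base (x ^+ p)%g k.+1 = (base (x ^+ p)%g k.+1 -
  base x k.+1 * \sum_(i < p ^ 1) twist x k.+1 ^+ i) +
  base x k.+1 * (twist x k.+1 - 1) ^+ (p ^ 1 - 1).
  by rewrite sum_expr_pchar ?subrK ?pchar_Fp.
apply: dvdp_add.
  rewrite expn1; apply: dvdp_trans (baseX p_prime x p k.+1).
  by rewrite dvdp_exp2l // ltnW // ltn_expl.
rewrite exprSr dvdp_mul ?lower_term_base_succ // expn1.
by rewrite -(subnSK p_gt1) exprS dvdp_mulr // dvdX_twist_sub1.
Qed.

(** In [base_comm] the term (1 - u_y) f_x gains a factor t over f_x, while (u_x - 1) f_y is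
    divisible by t^(p^k), and p^k > k. *)
Lemma lower_term_comm k x y : lower_term k x -> lower_term k.+1 [~ x, y]%g.
Proof.
move=> xk; apply/lower_term_base; split; first exact: zpart_comm.
rewrite -(Gauss_dvdpr _ (coprimep_twist (y * x)%g k.+1 k.+1)).
rewrite -[X in _ %| X](subrK ((1 - twist y k.+1) * base x k.+1 +
  (twist x k.+1 - 1) * base y k.+1)); apply: dvdp_add.
  apply: dvdp_trans (base_comm p_prime x y k.+1).
  by rewrite dvdp_exp2l // ltnW // ltn_expl.
apply: dvdp_add.
  by rewrite exprS dvdp_mul ?lower_term_base_succ // -dvdpNr opprB dvdX_twist_sub1.
rewrite dvdp_mulr //; apply: dvdp_trans (dvd_twist_sub1 p_prime (leqnSn k) xk.1).
by rewrite dvdp_exp2l // ltn_expl.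
Qed.

(* (f, b) = [(g, 0), (0, 1)] (0, b/p)^p, where g = -(1 + t) f / t. *)
Lemma lower_termS_gen k x : lower_term k.+1 x ->
  exists u v z, [/\ lower_term k u, lower_term k z & x = ([~ u, v] * z ^+ p)%g].
Proof.
move=> [x0 xc].
have zx_dvd j : (p %| zpart x j.+1)%N.
  have := zpart_dvd p_prime x (ltn0Sn j).
  by rewrite expn1 (@zpart_anti _ p_prime _ 1 k.+1).
have [u [uz uc]] : exists u : W p, zpart u =1 (fun=> 0%N) /\
    tcoef u =1 (fun a => - (tcoef x a.+1 + tcoef x a)).
  by apply: (@coord_surj p p_prime _ (fun=> 0%N)) => // j; rewrite mod0n.
(* The residue of 1 modulo p^j is 1, except at level 0, where it is 0. *)
have [v [vz vc]] : exists v : W p, zpart v =1 (fun j => nat_of_bool (j != 0%N)) /\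
    tcoef v =1 (fun=> 0).
  apply: (@coord_surj p p_prime _ (fun j => nat_of_bool (j != 0%N))) => // -[|j] //=.
    by rewrite -[1%N]/(p ^ 0)%N ltn_exp2l.
  by rewrite modn_small // -[1%N]/(p ^ 0)%N ltn_exp2l.
have [z [zz zc]] : exists z : W p, zpart z =1 (fun j => zpart x j.+1 %/ p)%N /\
    tcoef z =1 (fun=> 0).
  apply: (@coord_surj p p_prime _ (fun j => (zpart x j.+1 %/ p)%N)) => // j.
    by rewrite ltn_divLR // -expnSr zpart_lt.
  rewrite -(zpart_modS p_prime x j.+1).
  have /dvdnP[m ->] := zx_dvd j.+1.
  by rewrite mulnK // expnSr -muln_modl mulnK.
exists u, v, z; split.
- split=> [|a ltak]; first exact: uz.
  by rewrite uc !xc ?addr0 ?oppr0 // ltnW.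
- by split=> [|a ltak]; [rewrite zz x0 div0n | exact: zc].
have wz := zpart_comm p_prime u v; have wc := base_comm p_prime u v.
move: [~ u, v]%g wz wc => w wz wc.
have zpz j : zpart (z ^+ p)%g j = zpart x j.
  rewrite zpartX // zz mulnC divnK ?zx_dvd //.
  by rewrite zpart_modS.
have zpc a : tcoef (z ^+ p)%g a = 0.
  have zmc m b : tcoef (z ^+ m)%g b = 0; last exact: zmc.
  elim: m b => [|m IHm] b; first by rewrite expg0 tcoef1.
  by rewrite expgS tcoefM_lead ?IHm ?zc ?addr0.
apply: coord_inj => // [j|a].
  by rewrite zpartM // wz add0n zpz modn_small ?zpart_lt.
rewrite tcoefM_lead // zpc addr0.
have tv l : twist v l.+1 = 'X + 1 by rewrite /twist vz.
have tu l : twist u l = 1 by rewrite /twist uz.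
have tvu l : twist (v * u)%g l.+1 = 'X + 1.
  rewrite /twist zpartM // vz uz modn_small // -[X in (X < _)%N]/(p ^ 0)%N.
  by rewrite ltn_exp2l.
(* Coefficient of t^i in (1 + t) w = (1 + t) f, which is [base_comm] for this u and v: the element v
   u acts as 1 + t, and (1 - (1 + t)) g = (1 + t) f. *)
have rel i : tcoef w i + (if i is i'.+1 then tcoef w i' else 0) =
    tcoef x i + (if i is i'.+1 then tcoef x i' else 0).
  have ltil : (i < p ^ i.+1)%N by rewrite (ltn_trans (ltnSn i)) // ltn_expl.
  have /dvdp_XnP/(_ i ltil) := wc i.+1.
  rewrite tv tu tvu subrr mul0r addr0 opprD addrCA subrr addr0.
  rewrite mulNr mulrDl mul1r coefB coefN coefD !coefXM.
  case: i ltil => [|i] ltil /=.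
    by rewrite oppr0 subr0 add0r !addr0 -tcoefE // (xc 0%N).
  have ltil' : (i < p ^ i.+2)%N by rewrite ltnW.
  rewrite -!tcoefE // uc opprK addrC (addrC (tcoef w i)).
  by move=> /eqP; rewrite addrC subr_eq0 => /eqP.
elim: a => [|a IHa]; first by have := rel 0%N; rewrite !addr0.
by have := rel a.+1; rewrite -IHa => /addIr.
Qed.

(** Every element of the next term is a single commutator times a single p-th power, so it lies in
    any subgroup containing the generators; closedness matters only for the other inclusion. *)
Lemma lower_p_seriesE k : lower_p_series (W p) p k.+1 = lower_term k.
Proof.
rewrite /lower_p_series /=; elim: k => [|k IHk].
  by apply/seteqP; split=> x //= _; split=> //; exact: zpart0.
rewrite iterS {}IHk; apply/seteqP; split.
  apply: smallest_sub; first by split; [exact: lower_term_subgroup|exact: lower_term_closed].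
  move=> z [[x xk <-]|[x [y [xk ->]]]]; [exact: lower_termX|exact: lower_term_comm].
move=> x /lower_termS_gen[u [v [z [uk zk ->]]]] H [[[H1 HM HV] Hc] Hgen].
by apply: HM; apply: Hgen; [right; exists u, v|left; exists z].
Qed.
End LowerSeries.

(** * Indices and jumps *)

Lemma card_fset_set_image (T : finType) (U : choiceType) (f : T -> U) (A : {set T}) :
  {in A &, injective f} -> #|` fset_set (f @` [set` A])|%fset = #|A|.
Proof.
move=> f_inj; have -> : [set` A] = [set` [fset x in A]%fset].
  by apply/seteqP; split=> x /=; rewrite !inE.
rewrite fset_set_image // set_fsetK (_ : #|A| = #|` [fset x in A]%fset|)%N.
  by apply/eqP/card_in_imfsetP => x y; rewrite !inE; exact: f_inj.
by rewrite card_imfset //= -cardE.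
Qed.

(** * Counting cosets through F_p-valued coordinates with additive leading terms *)

Section CoordinateIndex.
Variables (p : nat) (p_prime : prime p) (G : topologicalGroupType).
Variable d : nat -> G -> 'F_p.
Hypothesis dM : forall i x z, (forall j, (j < i)%N -> d j z = 0) ->
  d i (x * z)%g = d i x + d i z.
Implicit Types (K : set G) (x y z : G).

Definition common_zero n : set G := [set x | forall i, (i < n)%N -> d i x = 0].

Definition jump K n : Prop := exists z, [/\ K z, common_zero n z & d n z != 0].

Definition jumps K n : nat := \sum_(i < n) `[< jump K i >].

Let coords n x : {ffun 'I_n -> 'F_p} := [ffun i => d (nat_of_ord i) x].

Let coordsP n x y : coords n x = coords n y <-> forall i, (i < n)%N -> d i x = d i y.
Proof.
split=> [/ffunP xy i ltin|xy]; first by have := xy (Ordinal ltin); rewrite !ffunE.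
by apply/ffunP => i; rewrite !ffunE xy.
Qed.

(** The left cosets of [common_zero n] are thus the fibres of the first n coordinates. *)
Lemma common_zero_ldiv n x z :
  common_zero n z <-> forall i, (i < n)%N -> d i (x * z)%g = d i x.
Proof.
split=> [z0 i ltin|xz].
  by rewrite dM ?z0 ?addr0 // => j ltji; rewrite z0 // (ltn_trans ltji).
elim/ltn_ind => i IHi ltin; have := xz i ltin.
rewrite dM => [|j ltji]; last by rewrite IHi // (ltn_trans ltji).
by rewrite -[X in _ = X]addr0 => /addrI.
Qed.

Lemma common_zeroX n z m : common_zero n z ->
  common_zero n (z ^+ m)%g /\ d n (z ^+ m)%g = d n z *+ m.
Proof.
move=> z0; have d1 i : d i 1%g = 0.
  by apply: ((common_zero_ldiv i.+1 1%g 1%g).2 _ i) => // j _; rewrite mulg1.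
elim: m => [|m [zm0 dzm]]; first by rewrite expg0 mulr0n; split=> // i _.
rewrite expgS; split; last by rewrite dM // dzm mulrS.
by move=> i ltin; rewrite ((common_zero_ldiv n z _).1 zm0) ?z0.
Qed.

Let image K n : {set {ffun 'I_n -> 'F_p}} :=
  [set t | `[< exists2 x, K x & coords n x = t >] ].

Let imageP K n t : reflect (exists2 x, K x & coords n x = t) (t \in image K n).
Proof. by rewrite inE; exact: asboolP. Qed.

(** Induction on n. At a jump z, multiplying by powers of z gives coordinate n every value in F_p
    without touching the earlier ones. Without a jump, elements of K agreeing in the first n
    coordinates also agree in coordinate n. *)
Let card_image K n : subgroup K -> #|image K n| = (p ^ jumps K n)%N.
Proof.
move=> [K1 KM KV]; rewrite /jumps; elim: n => [|n IHn].
  rewrite big_ord0 expn0; apply/eqP/cards1P; exists (coords 0 1%g).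
  apply/setP => t; rewrite finset.in_set1; apply/imageP/eqP => [[x Kx <-]|->].
    by apply/coordsP.
  by exists 1%g.
pose r (t : {ffun 'I_n.+1 -> 'F_p}) : {ffun 'I_n -> 'F_p} :=
  [ffun i => t (widen_ord (leqnSn n) i)].
have rq x : r (coords n.+1 x) = coords n x by apply/ffunP => i; rewrite !ffunE.
have qmax x : coords n.+1 x ord_max = d n x by rewrite ffunE.
have rmax_inj : injective (fun t => (r t, t ord_max)).
  move=> s t [/ffunP st stm]; apply/ffunP => i.
  have [lt_in|] := ltnP i n.
    by have := st (Ordinal lt_in); rewrite !ffunE; congr (s _ = t _); apply: val_inj.
  move=> le_ni; suff -> : i = ord_max by [].
  by apply/val_inj/eqP; rewrite eqn_leq le_ni -ltnS ltn_ord.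
rewrite big_ord_recr expnD -{}IHn /=; case: asboolP => [[z [Kz z0 zn]]|no_jump].
  rewrite expn1 -[X in _ = (_ * X)%N](card_Fp p_prime) -cardsT -cardsX.
  rewrite -(card_imset _ rmax_inj); apply: eq_card => -[s c]; rewrite !inE /= andbT.
  apply/imsetP/asboolP => [[t /imageP[x Kx <-] [-> _]]|[x Kx <-]].
    by exists x.
  (* The exponent solving d_n(x) + m d_n(z) = c in F_p. *)
  pose m := nat_of_ord ((c - d n x) / d n z).
  have [zm0 zmn] := common_zeroX m z0.
  have Kzm : K (z ^+ m)%g.
    elim: (m) => [|j IHj]; first by rewrite expg0.
    by rewrite expgS; exact: KM.
  exists (coords n.+1 (x * z ^+ m)%g).
    by apply/imageP; exists (x * z ^+ m)%g => //; exact: KM.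
  congr pair.
    by rewrite rq; apply/coordsP => i ltin; rewrite ((common_zero_ldiv n x _).1 zm0).
  rewrite qmax dM // zmn -mulr_natl natr_Zp divfK //; ring.
rewrite muln1; have -> : image K n = (r @: image K n.+1)%SET.
  apply/setP => s; apply/imageP/imsetP => [[x Kx <-]|[t /imageP[x Kx <-] ->]].
    by exists (coords n.+1 x) => //; apply/imageP; exists x.
  by exists x.
rewrite card_in_imset // => s t /imageP[x Kx <-] /imageP[y Ky <-].
rewrite !rq => /coordsP xy; apply: rmax_inj; rewrite !rq !qmax.
have [xy0 Kxy] : common_zero n (x^-1 * y)%g /\ K (x^-1 * y)%g.
  split; last by apply: KM => //; exact: KV.
  by apply/(common_zero_ldiv n x) => i ltin; rewrite mulVKg xy.
congr pair; first exact/coordsP.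
rewrite -[y](mulVKg x) dM //; have [-> |nz] := eqVneq (d n (x^-1 * y)%g) 0.
  by rewrite addr0.
by case: no_jump; exists (x^-1 * y)%g.
Qed.

Lemma coset_index_jumps K n : subgroup K ->
  coset_index (set_mulg K (common_zero n)) (common_zero n) = (p ^ jumps K n)%N.
Proof.
move=> Ksub; rewrite -card_image //.
pose fib (t : {ffun 'I_n -> 'F_p}) : set G := [set w | coords n w = t].
rewrite -(@card_fset_set_image _ _ fib) /coset_index; last first.
  move=> s t /imageP[x Kx <-] /imageP[y Ky <-] xy.
  by have : fib (coords n x) x by []; rewrite xy.
have cosE h : [set (h * x)%g | x in common_zero n] = fib (coords n h).
  apply/seteqP; split=> [_ [z z0 <-]|w]; first exact/coordsP/common_zero_ldiv.
  move/coordsP => wh; exists (h^-1 * w)%g; last by rewrite mulVKg.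
  by apply/(common_zero_ldiv n h) => i ltin; rewrite mulVKg wh.
congr #|` fset_set _|%fset; apply/seteqP; split=> [_ [_ [x Kx [z z0 <-]] <-]|].
  rewrite cosE; exists (coords n x); first by apply/imageP; exists x.
  by congr fib; apply/coordsP => i ltin; rewrite ((common_zero_ldiv n x _).1 z0).
move=> _ [_ /imageP[x Kx <-] <-]; exists x => //.
exists x => //; exists 1%g; rewrite ?mulg1 //.
by apply/(common_zero_ldiv n x) => i _; rewrite mulg1.
Qed.
End CoordinateIndex.

(** * Indices of the lower p-series of W in terms of jumps *)

Section Index.
Variables (p : nat) (p_prime : prime p).
Local Notation Fp := 'F_p.
Implicit Types (x y z w : W p) (K : set (W p)).

Let p_gt0 : (0 < p)%N := prime_gt0 p_prime.
Let p_gt1 : (1 < p)%N := prime_gt1 p_prime.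
Let pk_gt0 k : (0 < p ^ k)%N. Proof. by rewrite expn_gt0 p_gt0. Qed.

Lemma natr_Fp_eq0 n : (n%:R == 0 :> Fp) = (p %| n)%N.
Proof. by rewrite (dvdn_pcharf (pchar_Fp p_prime)). Qed.

(** The digit at p^i in the p-adic expansion of the Z_p part. *)
Definition zdigit x i : Fp := (zpart x i.+1 %/ p ^ i)%:R.

Lemma zdigit_eq0 x i : zpart x i = 0%N -> (zdigit x i == 0) = (zpart x i.+1 == 0%N).
Proof.
move=> /eqP; rewrite -(zpart_dvd p_prime x (leqnSn i)) => /dvdnP[u xu].
rewrite /zdigit natr_Fp_eq0 xu mulnK // muln_eq0 (gtn_eqF (pk_gt0 i)) orbF.
have : (u < p)%N by rewrite -(ltn_pmul2r (pk_gt0 i)) -xu -expnS zpart_lt.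
by case: u {xu} => [|u] ltup; rewrite ?dvdn0 // gtnNdvd.
Qed.

Lemma zpart_eq0 x k : zpart x k = 0%N <-> forall i, (i < k)%N -> zdigit x i = 0.
Proof.
split=> [xk i ltik|].
  apply/eqP; rewrite zdigit_eq0; last exact: zpart_anti (ltnW ltik) xk.
  by apply/eqP; exact: zpart_anti ltik xk.
elim: k => [|k IHk] dig0; first exact: zpart0.
by apply/eqP; rewrite -zdigit_eq0 ?dig0 // IHk // => i ltik; rewrite dig0 // ltnW.
Qed.

(** Since p^i divides the part of z, no carry reaches digit i, and reducing modulo p^(i+1) changes
    the quotient by a multiple of p. *)
Lemma zdigitM_lead x z i : zpart z i = 0%N ->
  zdigit (x * z)%g i = zdigit x i + zdigit z i.
Proof.
move=> /eqP; rewrite -(zpart_dvd p_prime z (leqnSn i)) => zi.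
rewrite /zdigit zpartM // -natrD -divnDr //.
set s := (_ + _)%N; rewrite [in RHS](divn_eq s (p ^ i.+1)) divnDl; last first.
  by rewrite dvdn_mull // dvdn_exp2l.
by rewrite expnS mulnA mulnK // natrD natrM (pchar_Fp_0 p_prime) mulr0 add0r.
Qed.

(* The first k coordinates see the quotient Z/p^k, the following ones the
   power series part, in the order of the filtration of W by its subgroups
   t^a F_p[[t]] x| p^k Z_p. *)
Definition coord k i x : Fp := if (i < k)%N then zdigit x i else tcoef x (i - k).

Lemma coord_addn k a x : coord k (k + a) x = tcoef x a.
Proof. by rewrite /coord ltnNge leq_addr /= addKn. Qed.

Lemma coordM k i x z : (forall j, (j < i)%N -> coord k j z = 0) ->
  coord k i (x * z)%g = coord k i x + coord k i z.
Proof.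
case: (ltnP i k) => [ltik|leki] z0; rewrite /coord.
  rewrite ltik; apply: zdigitM_lead; apply/zpart_eq0 => j ltji.
  by have := z0 j ltji; rewrite /coord (ltn_trans ltji).
rewrite ltnNge leki /=; apply: tcoefM_lead => // j ltj; have := z0 (k + j)%N.
by rewrite coord_addn -ltn_subRL; exact.
Qed.

Lemma common_zero_coord k a x : common_zero (coord k) (k + a) x <->
  zpart x k = 0%N /\ forall j, (j < a)%N -> tcoef x j = 0.
Proof.
split=> [x0|[x0 xc] i lti].
  split=> [|j ltja].
    apply/zpart_eq0 => i ltik; have := x0 i; rewrite /coord ltik; apply.
    by rewrite ltn_addr.
  have := x0 (k + j)%N; by rewrite coord_addn ltn_add2l; exact.
rewrite /coord; case: ltnP => [ltik|leki]; first by rewrite ((zpart_eq0 x k).1 x0).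
by rewrite xc // -(ltn_add2l k) subnKC.
Qed.

Definition zjump K i : Prop :=
  exists x, [/\ K x, zpart x i = 0%N & zpart x i.+1 != 0%N].

Definition tjump K k a : Prop :=
  exists x, [/\ K x, zpart x k = 0%N, forall j, (j < a)%N -> tcoef x j = 0
             & tcoef x a != 0].

Definition zjumps K k : nat := \sum_(i < k) `[< zjump K i >].
Definition tjumps K k : nat := \sum_(a < k) `[< tjump K k a >].

Lemma jumps_coord K k : jumps (coord k) K (k + k) = (zjumps K k + tjumps K k)%N.
Proof.
rewrite /jumps big_split_ord; congr (_ + _)%N; apply: eq_bigr => i _;
  congr (nat_of_bool _); apply: asbool_equiv_eq; split=> -[x].
- move=> [Kx x0]; rewrite /coord /= ltn_ord => xi.
  have {x0} x0 : zpart x i = 0%N.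
    apply/zpart_eq0 => j ltji; have := x0 j ltji.
    by rewrite /coord (ltn_trans ltji).
  by exists x; rewrite -zdigit_eq0.
- move=> [Kx x0 xi]; exists x; split=> //; last by rewrite /coord /= ltn_ord zdigit_eq0.
  by move=> j ltji; rewrite /coord (ltn_trans ltji (ltn_ord i)) ((zpart_eq0 x i).1 x0).
- move=> [Kx /common_zero_coord[x0 xc]].
  by rewrite coord_addn => xi; exists x.
- move=> [Kx x0 xc xi]; exists x; split=> //; first exact/common_zero_coord.
  by rewrite coord_addn.
Qed.

(** The term P_(k+1) is the common zero set of the first 2k coordinates: k digits, then k
    coefficients. *)
Lemma coset_index_lower K k : subgroup K ->
  let P := lower_p_series (W p) p k.+1 in
  coset_index (set_mulg K P) P = (p ^ (zjumps K k + tjumps K k))%N.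
Proof.
move=> Ksub /=; rewrite lower_p_seriesE // -jumps_coord.
have -> : lower_term k = common_zero (coord k) (k + k) :> set (W p).
  by apply/seteqP; split=> x /common_zero_coord.
by apply: coset_index_jumps => // i x z; exact: coordM.
Qed.

Lemma zgen_ex i : exists x : W p,
  zpart x =1 (fun k => p ^ i %% p ^ k)%N /\ tcoef x =1 (fun=> 0).
Proof.
apply: (@coord_surj p p_prime _ (fun k => p ^ i %% p ^ k)%N) => k.
  by rewrite ltn_mod.
by rewrite modn_dvdm // dvdn_exp2l.
Qed.

Lemma tgen_ex a : exists x : W p,
  zpart x =1 (fun=> 0)%N /\ tcoef x =1 (fun j => (j == a)%:R).
Proof. by apply: (@coord_surj p p_prime _ (fun=> 0%N)) => // k; rewrite mod0n. Qed.

(** All 2k places are jumps of W, through the elements (0, p^i) and (t^a, 0). *)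
Lemma coset_index_lowerT k :
  coset_index [set: W p] (lower_p_series (W p) p k.+1) = (p ^ (k + k))%N.
Proof.
pose P := lower_p_series (W p) p k.+1.
have -> : [set: W p] = set_mulg setT P.
  apply/seteqP; split=> // x _; exists x => //; exists 1%g; rewrite ?mulg1 //.
  by rewrite /P lower_p_seriesE //; case: (lower_term_subgroup p_prime k).
rewrite coset_index_lower //; congr (_ ^ (_ + _))%N.
  rewrite /zjumps -[RHS]card_ord -sum1_card; apply: eq_bigr => i _.
  suff /asboolP -> : zjump setT i by [].
  have [x [xz _]] := zgen_ex i; exists x; rewrite !xz modnn modn_small ?ltn_exp2l //.
  by rewrite -lt0n.
rewrite /tjumps -[RHS]card_ord -sum1_card; apply: eq_bigr => a _.
suff /asboolP -> : tjump setT k a by [].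
have [x [xz xc]] := tgen_ex a; exists x; split=> // [j ltja|]; rewrite xc.
  by rewrite ltn_eqF.
by rewrite eqxx oner_eq0.
Qed.

Lemma hdim_quotientE (R : realType) K k : subgroup K ->
  hdim_quotient R p K k.+1 = (zjumps K k + tjumps K k)%:R / (k + k)%:R.
Proof.
move=> Ksub; rewrite /hdim_quotient coset_index_lower // coset_index_lowerT.
have lnp : ln p%:R != 0 :> R by rewrite gt_eqF // ln_gt0 // ltr1n.
have logX n : log_nat R p (p ^ n) = n%:R.
  by rewrite /log_nat natrX lnXn ?ltr0n // -[ln _ *+ n]mulr_natl mulfK.
by rewrite !logX.
Qed.
End Index.

(** * Jumps of a subgroup of W *)

(* A set of naturals stable under a |-> a + Q is, from some point on, a union of
   residue classes modulo Q, so its counting function is linear up to O(1). *)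
Lemma count_shift_stable (S : pred nat) (Q : nat) : (0 < Q)%N ->
    (forall a, S a -> S (a + Q)%N) ->
  exists m C, (m <= Q)%N /\ forall k, let s := (\sum_(a < k) S a)%N in
    (Q * s <= m * k + C)%N /\ (m * k <= Q * s + C)%N.
Proof.
move=> Q_gt0 SQ; pose s k := (\sum_(a < k) S a)%N.
have sS k : s k.+1 = (s k + S k)%N by rewrite /s big_ord_recr.
have s_le i j : (s i <= s (i + j) <= s i + j)%N.
  elim: j => [|j /andP[IH1 IH2]]; first by rewrite !addn0 leqnn.
  by rewrite !addnS sS; case: (S _) => /=; lia.
(* The increment s(k + Q) - s(k) is nondecreasing in k, as passing from k to k + 1 adds S(k + Q) -
   S(k). Being at most Q, it attains a maximum m and stays there. *)
have e_mono i j : (s (i + Q) + s (i + j) <= s (i + j + Q) + s i)%N.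
  elim: j => [|j IHj]; first by rewrite addn0.
  rewrite addnS addSn !sS; have := SQ (i + j)%N.
  by case: (S (i + j)%N) => [->|_] //=; lia.
pose P e := `[< exists k, s (k + Q)%N = (s k + e)%N >].
have exP : exists e, P e.
  exists (s Q); apply/asboolP; exists 0%N.
  by rewrite /s big_ord0 !add0n.
have leP e : P e -> (e <= Q)%N.
  by move=> /asboolP[k ek]; have := s_le k Q; lia.
case: (ex_maxnP exP leP) => m Pm m_max.
have m_le := leP _ Pm; move/asboolP: Pm => [N eN].
have e_const k : (N <= k)%N -> s (k + Q)%N = (s k + m)%N.
  move=> /subnKC <-; set j := (k - N)%N.
  have le1 := e_mono N j; have /andP[le2 _] := s_le (N + j)%N Q.
  have le3 : (s (N + j + Q) - s (N + j) <= m)%N.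
    by apply: m_max; apply/asboolP; exists (N + j)%N; rewrite subnKC.
  lia.
(* For k < N + Q both Q s(k) and m k are at most Q (N + Q); from there on, k and k - Q have the same
   discrepancy. *)
exists m, (Q * (N + Q))%N; split=> //; elim/ltn_ind => k IHk.
have [lt_k|le_k] := ltnP k (N + Q).
  have sk : (s k <= k)%N by have := s_le 0%N k; rewrite add0n /s big_ord0; lia.
  by rewrite -!/(s k); split; nia.
have [] := IHk (k - Q)%N; first by lia.
have := e_const (k - Q)%N; rewrite subnK; last by lia.
rewrite -!/(s _); set s' := s (k - Q)%N; move=> -> ; last by lia.
have -> : (m * k = m * (k - Q) + m * Q)%N by rewrite -mulnDr subnK //; lia.
by move=> h1 h2; split; nia.
Qed.

Section Jumps.
Variables (p : nat) (p_prime : prime p).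
Local Notation Fp := 'F_p.
Implicit Types (x y z w : W p) (K : set (W p)).

Let p_gt0 : (0 < p)%N := prime_gt0 p_prime.
Let p_gt1 : (1 < p)%N := prime_gt1 p_prime.
Let pk_gt0 k : (0 < p ^ k)%N. Proof. by rewrite expn_gt0 p_gt0. Qed.

Lemma subgroupX K x m : subgroup K -> K x -> K (x ^+ m)%g.
Proof.
move=> [K1 KM _] Kx; elim: m => [|m IHm]; first by rewrite expg0.
by rewrite expgS; exact: KM.
Qed.

Lemma subgroup_comm K x y : subgroup K -> K x -> K y -> K [~ x, y]%g.
Proof.
move=> [_ KM KV] Kx Ky; rewrite commgEl conjgE.
exact: KM _ _ (KV _ Kx) (KM _ _ (KV _ Ky) (KM _ _ Kx Ky)).
Qed.

Lemma zpartXp_eq0 x n j : zpart x n = 0%N -> zpart (x ^+ (p ^ j))%g (n + j) = 0%N.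
Proof.
move=> x0; rewrite zpartX //.
have /dvdnP[u ->] : (p ^ n %| zpart x (n + j))%N by rewrite zpart_dvd ?leq_addr // x0.
by rewrite mulnC -mulnA -expnD modnMl.
Qed.

Lemma zpartXp_neq0 x n j :
  zpart x n.+1 != 0%N -> zpart (x ^+ (p ^ j))%g (n + j).+1 != 0%N.
Proof.
apply: contra_neq; rewrite zpartX // => /eqP; rewrite -/(dvdn _ _) -addSn addnC expnD.
rewrite dvdn_pmul2l // zpart_dvd ?leq_addl //; first by move/eqP.
Qed.

Lemma zjump_addn K n j : subgroup K -> zjump K n -> zjump K (n + j).
Proof.
move=> Ksub [x [Kx x0 xn]]; exists (x ^+ (p ^ j))%g; split.
- exact: subgroupX.
- exact: zpartXp_eq0.
- exact: zpartXp_neq0.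
Qed.

Lemma zjumpsE K n k : subgroup K -> zjump K n -> (forall i, zjump K i -> (n <= i)%N) ->
  zjumps K k = (k - n)%N.
Proof.
move=> Ksub Kn n_min; rewrite /zjumps; elim: k => [|k IHk]; first by rewrite big_ord0.
rewrite big_ord_recr {}IHk /=; case: asboolP => [/n_min le_nk|nk].
  by rewrite addn1 subSn.
rewrite addn0; apply/eqP; rewrite eq_sym; move: nk; case: (leqP n k) => [le_nk|lt_kn _].
  by case; rewrite -(subnKC le_nk); exact: zjump_addn.
by apply/eqP; lia.
Qed.

(** The base part of x^(p^j) is f (u - 1)^(p^j - 1), where t^(p^n) divides u - 1. *)
Lemma tcoefXp_eq0 x n j a : zpart x n = 0%N -> (a < p ^ n * (p ^ j - 1))%N ->
  tcoef (x ^+ (p ^ j))%g a = 0.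
Proof.
(* A level that is at least n and satisfies a < p^k. *)
move=> x0 lta; pose k := (n + a)%N.
have ltak : (a < p ^ k)%N.
  by apply: (@leq_trans (p ^ a)%N); [rewrite ltn_expl|rewrite leq_pexp2l // leq_addl].
rewrite (tcoefE p_prime _ ltak).
have /dvdp_XnP/(_ a ltak) := baseX p_prime x (p ^ j) k.
rewrite coefB sum_expr_pchar ?pchar_Fp // => /eqP; rewrite subr_eq0 => /eqP ->.
have dvd : 'X^(p ^ n * (p ^ j - 1)) %| base x k * (twist x k - 1) ^+ (p ^ j - 1);
  last by move/dvdp_XnP: dvd; apply.
rewrite dvdp_mull // exprM dvdp_exp2r //.
by apply: dvd_twist_sub1 => //; exact: leq_addr.
Qed.

(** Lets [tcoefXp_eq0] with j = k - n kill all coefficients below t^k. The right side is p^k - p^n,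
    at least p^(k-1), which exceeds k - 1. *)
Lemma leq_subX n k : (n < k)%N -> (k <= p ^ n * (p ^ (k - n) - 1))%N.
Proof.
case: k => // k; rewrite ltnS => le_nk.
rewrite mulnBr muln1 -expnD subnKC; last by rewrite leqW.
have : (k < p ^ k)%N by rewrite ltn_expl.
have : (p ^ n <= p ^ k)%N by rewrite leq_pexp2l.
have : (2 * p ^ k <= p ^ k.+1)%N by rewrite expnS leq_mul2r p_gt1 orbT.
lia.
Qed.

(** The element z = y^(p^(k-n)) has nonzero digit k and no coefficients below t^k, so a power of it
    cancels digit k of x and leaves those coefficients of x alone. *)
Lemma tjump_succ K n k a : subgroup K -> zjump K n -> (n < k)%N -> (a < k)%N ->
  tjump K k a -> tjump K k.+1 a.
Proof.
move=> Ksub [y [Ky y0 yn]] lt_nk lt_ak [x [Kx x0 xc xa]].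
have kE := subnKC (ltnW lt_nk); pose z := (y ^+ (p ^ (k - n)))%g.
have z0 : zpart z k = 0%N by rewrite -[k in zpart _ k]kE zpartXp_eq0.
have zS : zpart z k.+1 != 0%N by rewrite -[k in zpart _ k.+1]kE zpartXp_neq0.
have zdig : zdigit z k != 0 by rewrite zdigit_eq0.
have zc j : (j < k)%N -> tcoef z j = 0.
  by move=> ltjk; exact: tcoefXp_eq0 y0 (leq_trans ltjk (leq_subX lt_nk)).
have zX l : [/\ zpart (z ^+ l)%g k = 0%N, zdigit (z ^+ l)%g k = zdigit z k *+ l
             & forall j, (j < k)%N -> tcoef (z ^+ l)%g j = 0].
  elim: l => [|l [IH1 IH2 IH3]].
    rewrite expg0 mulr0n /zdigit !zpart1 div0n; split=> // j _; exact: tcoef1.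
  rewrite expgS; split; first exact: zpart_eq0M.
    by rewrite zdigitM_lead // IH2 mulrS.
  move=> j ltjk; rewrite tcoefM_lead // => [|i ltij]; first by rewrite IH3 // zc // addr0.
  by rewrite IH3 // (ltn_trans ltij).
have [zl0 zlS zlc] := zX (nat_of_ord (- zdigit x k / zdigit z k)).
set v := (z ^+ _)%g in zl0 zlS zlc.
have Kv : K v by apply: subgroupX => //; exact: subgroupX.
have xv j : (j < k)%N -> tcoef (x * v)%g j = tcoef x j.
  move=> ltjk; rewrite tcoefM_lead // => [|i ltij]; first by rewrite zlc ?addr0.
  by rewrite zlc // (ltn_trans ltij).
exists (x * v)%g; split.
- by case: Ksub => _ KM _; exact: KM.
- apply/eqP; rewrite -zdigit_eq0 //; last exact: zpart_eq0M.
  by rewrite zdigitM_lead // zlS -mulr_natl natr_Zp divfK // addrN.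
- by move=> j ltja; rewrite xv ?xc // (ltn_trans ltja).
- by rewrite xv.
Qed.

Lemma tjump_addn K n k i a : subgroup K -> zjump K n -> (n < k)%N -> (a < k)%N ->
  tjump K k a <-> tjump K (k + i) a.
Proof.
move=> Ksub Kn lt_nk lt_ak; split=> [ka|[x [Kx x0 xc xa]]].
  elim: i => [|i IHi]; first by rewrite addn0.
  by rewrite addnS; apply: (tjump_succ Ksub Kn) => //; exact: ltn_addr.
by exists x; split=> //; exact: (@zpart_anti _ p_prime _ _ (k + i) (leq_addr _ _)).
Qed.

(** Level n + a + 1 exceeds both n and a, so it can stand for every admissible k and gives a set of
    valuations independent of k. *)
Lemma tjump_stable K n k a : subgroup K -> zjump K n -> (n < k)%N -> (a < k)%N ->
  tjump K (n + a).+1 a <-> tjump K k a.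
Proof.
move=> Ksub Kn lt_nk lt_ak.
have [le_k|le_k] := leqP k (n + a).+1.
  by rewrite -(subnKC le_k); apply: iff_sym; apply: tjump_addn (Kn) _ _.
rewrite -[X in _ <-> tjump K X a](subnKC (ltnW le_k)).
by apply: (tjump_addn _ Ksub Kn); lia.
Qed.

(** At level k, x acts trivially, so up to a unit [x, y] has base part (1 - u_y) f, where u_y - 1
    has valuation exactly p^n. *)
Lemma tjump_shift K n k a : subgroup K -> zjump K n -> (a + p ^ n < k)%N -> (n < k)%N ->
  tjump K k a -> tjump K k (a + p ^ n).
Proof.
move=> Ksub [y [Ky y0 yn]] ltk lt_nk [x [Kx x0 xc xa]].
have ltapk : (a + p ^ n < p ^ k)%N by rewrite (ltn_trans ltk) // ltn_expl.
have ltak : (a < p ^ k)%N by rewrite (leq_ltn_trans _ ltapk) // leq_addr.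
have [r yr r0] := twist_sub1 p_prime (ltnW lt_nk) y0.
have {}r0 : r`_0 != 0.
  (* Otherwise p^(n+1) would divide the Z_p part of y. *)
  rewrite r0 natr_Fp_eq0 //; apply: contraNN yn => dvd_p.
  rewrite -(zpart_dvd p_prime y lt_nk) -(divnK (_ : p ^ n %| zpart y k)%N).
    by rewrite expnS dvdn_mul.
  by rewrite zpart_dvd ?y0 // ltnW.
have dvdx : 'X^a %| base x k by apply/(dvd_base p_prime) => //; exact: ltnW.
pose N := (a + p ^ n)%N.
have rel := base_comm p_prime x y k.
have tx1 : twist x k = 1 by rewrite /twist x0.
rewrite tx1 subrr mul0r addr0 in rel.
have dvdR : 'X^N %| (1 - twist y k) * base x k.
  by rewrite -opprB yr mulNr dvdpNr /N addnC exprD dvdp_mul // dvdp_mull.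
have {}rel : 'X^(N.+1) %|
    twist (y * x)%g k * base [~ x, y]%g k - (1 - twist y k) * base x k.
  by apply: dvdp_trans rel; rewrite dvdp_exp2l.
have dvdw : 'X^N %| base [~ x, y]%g k.
  rewrite -(Gauss_dvdpr _ (coprimep_twist (y * x)%g k N)).
  rewrite -[X in _ %| X](subrK ((1 - twist y k) * base x k)) dvdp_add //.
  by apply: dvdp_trans rel; rewrite dvdp_exp2l.
exists [~ x, y]%g; split.
- exact: subgroup_comm.
- exact: zpart_comm.
- by apply/(dvd_base p_prime _ (ltnW ltapk)).
rewrite (tcoefE p_prime _ ltapk).
have /dvdp_XnP/(_ N (ltnSn _)) := rel.
rewrite coefB coef_mul_lead // coef0_twist mul1r => /eqP; rewrite subr_eq0 => /eqP ->.
rewrite -opprB yr mulNr coefN oppr_eq0 mulrAC coefMXn /N ltnNge leq_addl /= addnK.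
by rewrite coef_mul_lead // mulf_neq0 // -(tcoefE p_prime _ ltak).
Qed.

Lemma jumps_asymptotics K n : subgroup K -> zjump K n ->
    (forall i, zjump K i -> (n <= i)%N) ->
  exists m C, (m <= p ^ n)%N /\ forall k, (n < k)%N ->
    zjumps K k = (k - n)%N /\
    (p ^ n * tjumps K k <= m * k + C)%N /\ (m * k <= p ^ n * tjumps K k + C)%N.
Proof.
move=> Ksub Kn n_min; pose S a := `[< tjump K (n + a).+1 a >].
have SQ a : S a -> S (a + p ^ n)%N.
  move=> /asboolP Sa; apply/asboolP; have lt0 := pk_gt0 n.
  have lt1 : (n < (n + (a + p ^ n)).+1)%N by lia.
  have lt2 : (a < (n + (a + p ^ n)).+1)%N by lia.
  apply: (tjump_shift Ksub Kn) => //; first by lia.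
  exact: (tjump_stable Ksub Kn lt1 lt2).1.
have [m [C [le_m mC]]] := count_shift_stable (pk_gt0 n) SQ.
exists m, C; split=> // k lt_nk; split; first exact: zjumpsE.
have -> : tjumps K k = (\sum_(a < k) S a)%N; last exact: mC.
apply: eq_bigr => a _; congr nat_of_bool; apply: asbool_equiv_eq.
by apply: iff_sym; apply: tjump_stable.
Qed.
End Jumps.

(** * Dimensions *)

Lemma cvg_linear_rate (R : realType) (u : nat -> R) (l B : R) (N : nat) :
  (forall k, (N < k)%N -> `|l - u k| <= B / k%:R) -> u @ \oo --> l.
Proof.
move=> u_rate; apply/cvgrPdist_le => e e_gt0; near=> k.
have lt_Nk : (N < k)%N by near: k; exact: nbhs_infty_gt.
have k_gt0 : 0 < k%:R :> R by rewrite ltr0n (leq_ltn_trans _ lt_Nk).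
apply: (le_trans (u_rate k lt_Nk)); rewrite ler_pdivrMr // mulrC -ler_pdivrMr //.
by near: k; exact: nbhs_infty_ger.
Unshelve. all: by end_near.
Qed.

Lemma limn_inf_bounds (R : realType) (u : nat -> R) (a b : R) :
  (forall n, a <= u n <= b) -> a <= limn_inf u <= b.
Proof.
move=> ab; have u_bnd : bounded_fun u.
  exists (`|a| + `|b|); split; first exact: num_real.
  move=> M /ltW leM n _; apply: le_trans leM; have /andP[an nb] := ab n.
  by rewrite ler_norml; apply/andP; split;
    have := ler_norm b; have := lerNnormlW (lexx `|a|); have := normr_ge0 a;
    have := normr_ge0 b; lra.
rewrite limn_infE //.
have lb n : has_lbound (sdrop u n) by exists a => _ [k _ <-]; case/andP: (ab k).
have infs_le n : infs u n <= b.
  have /andP[_ nb] := ab n; apply: le_trans nb.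
  by apply: ge_inf => //; exists n => /=.
have infs_ge : a <= infs u 0%N.
  by apply: lb_le_inf; [exists (u 0%N), 0%N|move=> _ [k _ <-]; case/andP: (ab k)].
apply/andP; split.
  apply: (le_trans infs_ge); apply: ub_le_sup; last by exists 0%N.
  by exists b => _ [n _ <-].
by apply: ge_sup; [exists (infs u 0%N), 0%N|move=> _ [n _ <-]].
Qed.

(** Each full period contributes m, the incomplete last one min(m, k mod Q). *)
Lemma sum_modn_lt (Q m k : nat) : (m <= Q)%N -> (0 < Q)%N ->
  (\sum_(a < k) (a %% Q < m) = m * (k %/ Q) + minn m (k %% Q))%N.
Proof.
move=> le_mQ Q_gt0; elim: k => [|k IHk].
  by rewrite big_ord0 div0n mod0n minn0 muln0.
rewrite big_ord_recr {}IHk /= divnS // modnS.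
have ltr := ltn_pmod k Q_gt0; have kE := divn_eq k Q.
case: ifP => [/dvdnP[q kq]|_]; last by case: ltnP => ?; lia.
have rE : (k %% Q).+1 = Q.
  have : ((k %/ Q * Q + (k %% Q).+1) = q * Q)%N by rewrite addnS -kE.
  have := ltr; case: (ltnP (k %/ Q) q) => h; last by nia.
  have : (k %/ Q * Q + Q <= q * Q)%N by rewrite addnC -mulSn leq_mul2r h orbT.
  lia.
by rewrite minn0 mulnDr; case: ltnP => ?; lia.
Qed.

(** * Values of the dimension and subgroups attaining them *)

Section Spectrum.
Variables (R : realType) (p : nat) (p_prime : prime p).
Local Notation Fp := 'F_p.
Implicit Types (x y z w : W p) (K : set (W p)).

Let p_gt0 : (0 < p)%N := prime_gt0 p_prime.
Let p_gt1 : (1 < p)%N := prime_gt1 p_prime.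
Let pk_gt0 k : (0 < p ^ k)%N. Proof. by rewrite expn_gt0 p_gt0. Qed.

Lemma cvg_hdim K l : hdim_quotient R p K @ \oo --> l -> hdim R p K = l.
Proof. by move=> /cvg_limn_inf_sup[]. Qed.

Lemma hdim_quotient_rate K (l B : R) (N : nat) : subgroup K ->
    (forall k, (N < k)%N ->
       `|l - (zjumps K k + tjumps K k)%:R / (k + k)%:R| <= B / k%:R) ->
  hdim_quotient R p K @ \oo --> l.
Proof.
move=> Ksub rate; rewrite -cvg_shiftS; apply: (@cvg_linear_rate _ _ _ B N) => k lt_Nk.
by rewrite /= hdim_quotientE //; exact: rate.
Qed.

Lemma hdim_quotient_linear K (n m C : nat) : subgroup K ->
    (forall k, (n < k)%N -> zjumps K k = (k - n)%N /\
      (p ^ n * tjumps K k <= m * k + C)%N /\ (m * k <= p ^ n * tjumps K k + C)%N) ->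
  hdim_quotient R p K @ \oo --> (1 / 2 + m%:R / (2 * p%:R ^+ n) : R).
Proof.
move=> Ksub asym; apply: (@hdim_quotient_rate _ _ (n + C)%:R n) => // k lt_nk.
have [-> [le1 le2]] := asym k lt_nk; rewrite -natrX.
set t := tjumps K k in le1 le2 *; set Q := (p ^ n)%N in le1 le2 *.
have Q1 : 1 <= Q%:R :> R by rewrite ler1n pk_gt0.
have k0 : 0 < k%:R :> R by rewrite ltr0n (leq_ltn_trans _ lt_nk).
move: le1 le2; rewrite -!(ler_nat R) !natrD !natrM natrB ?(ltnW lt_nk) //.
have : 0 <= n%:R :> R by [].
have : 0 <= C%:R :> R by [].
clear asym lt_nk; clearbody t Q; move: k0 Q1.
move: (k%:R) (Q%:R) (m%:R) (t%:R) (C%:R) (n%:R) => {}k {}Q {}m {}t {}C {}n.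
move=> k0 Q1 C0 n0 le1 le2.
have Q0 : 0 < Q by lra.
(* Here |m k - Q t| <= C and Q >= 1, so the error is at most (n + C) / k. *)
have -> : 1 / 2 + m / (2 * Q) - (k - n + t) / (k + k) =
    (n * Q + (m * k - Q * t)) / (2 * k * Q).
  by field; rewrite !gt_eqF //; lra.
have D0 : 0 < 2 * k * Q by rewrite !mulr_gt0.
rewrite normrM normfV (gtr0_norm D0) ler_pdivrMr //.
have -> : (n + C) / k * (2 * k * Q) = 2 * Q * (n + C) by field; rewrite gt_eqF.
have nQ : 0 <= n * Q by rewrite mulr_ge0 // ltW.
have CQ : C <= C * Q by rewrite ler_peMr.
by rewrite ler_norml; apply/andP; split; nra.
Qed.

Lemma tjumps_le K k : (tjumps K k <= k)%N.
Proof.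
rewrite -[X in (_ <= X)%N]card_ord -sum1_card; apply: leq_sum => a _.
exact: leq_b1.
Qed.

Lemma hdim_base K : subgroup K -> (forall i, ~ zjump K i) -> 0 <= hdim R p K <= 1 / 2.
Proof.
move=> Ksub nz; apply: limn_inf_bounds => i.
have bnd k : 0 <= hdim_quotient R p K k.+1 <= 1 / 2.
  rewrite hdim_quotientE // /zjumps big1 ?add0n => [|j _]; last first.
    by case: asboolP => // /nz.
  rewrite divr_ge0 //=; have [->|k_gt0] := posnP k.
    by rewrite invr0 mulr0 divr_ge0.
  have k0 : 0 < k%:R :> R by rewrite ltr0n.
  rewrite ler_pdivrMr ?ltr0n ?addn_gt0 ?k_gt0 // natrD.
  have : (tjumps K k)%:R <= k%:R :> R by rewrite ler_nat tjumps_le.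
  lra.
(* The terms of index 0 and 1 of the lower p-series coincide. *)
by case: i => [|i]; [exact: (bnd 0%N)|exact: bnd].
Qed.

(** Power series supported on S, with Z_p part restricted at the levels in Z: [predT] gives subsets
    of the base group, [pred1 n] the Z_p parts in p^n Z_p. *)
Definition graded_set (Z S : pred nat) : set (W p) :=
  [set x | (forall k, Z k -> zpart x k = 0%N) /\ (forall a, ~~ S a -> tcoef x a = 0)].

Lemma closed_graded_set Z S : closed (graded_set Z S).
Proof.
have -> : graded_set Z S =
    (\bigcap_(k in [set k | Z k]) [set x : W p | zpart x k = 0%N]) `&`
    (\bigcap_(a in [set a | ~~ S a]) [set x : W p | tcoef x a = 0]) by [].
by apply: closedI; apply: closed_bigI => i _; [exact: closed_zpart|exact: closed_tcoef].
Qed.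

Lemma coef_mul_XnD1_off (S : pred nat) Q M u (q : {poly Fp}) :
    (forall a, S a -> S (a + Q)%N) -> (forall a, (a < M)%N -> ~~ S a -> q`_a = 0) ->
  forall a, (a < M)%N -> ~~ S a -> (('X^Q + 1) ^+ u * q)`_a = 0.
Proof.
move=> SQ q0; elim: u => [|u IHu] a ltaM nSa; first by rewrite mul1r q0.
rewrite exprS -mulrA mulrDl mul1r coefD coefXnM [X in _ + X]IHu // addr0.
case: ltnP => // le_Qa; apply: IHu; first by rewrite (leq_ltn_trans (leq_subr _ _)).
by apply: contraNN nSa => /SQ; rewrite subnK.
Qed.

(** If S is stable under adding Q, multiplication by powers of 1 + t^Q preserves support in S, so
    closure follows once the elements act by such powers. *)
Lemma subgroup_graded_set (Z S : pred nat) Q N :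
    (forall a, S a -> S (a + Q)%N) ->
    (forall x, (forall k, Z k -> zpart x k = 0%N) ->
       forall k, (N <= k)%N -> exists u, twist x k = ('X^Q + 1) ^+ u) ->
  subgroup (graded_set Z S).
Proof.
move=> SQ twQ.
have mul0 x y a : (forall k, Z k -> zpart x k = 0%N) ->
    (forall j, ~~ S j -> tcoef y j = 0) -> ~~ S a ->
    tcoef (x * y)%g a = tcoef x a.
  move=> xZ yS nSa; pose k := (N + a)%N.
  have ltak : (a < p ^ k)%N.
    by rewrite (leq_trans (ltn_expl a p_gt1)) // leq_exp2l // leq_addl.
  have [u tw] := twQ x xZ k (leq_addr _ _).
  have /dvdp_XnP/(_ a ltak) := baseM p_prime x y k.
  rewrite coefB coefD -/(twist x k) tw (coef_mul_XnD1_off u SQ _ ltak) ?addr0 //.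
    by rewrite -!(tcoefE p_prime _ ltak) => /eqP; rewrite subr_eq0 => /eqP.
  by move=> j ltjk nSj; rewrite -tcoefE ?yS.
split=> [|x y [xZ xS] [yZ yS]|x [xZ xS]].
- by split=> [k _|a _]; [exact: zpart1|exact: tcoef1].
- split=> [k Zk|a nSa]; first by apply: zpart_eq0M; rewrite ?xZ ?yZ.
  by rewrite mul0 // xS.
- have xVZ k : Z k -> zpart x^-1%g k = 0%N by move=> Zk; rewrite zpartV_eq0 ?xZ.
  split=> // a nSa; have := mul0 x^-1%g x a xVZ xS nSa.
  by rewrite mulVg tcoef1.
Qed.

Lemma tjumps_graded_set Z S k : tjumps (graded_set Z S) k = (\sum_(a < k) S a)%N.
Proof.
apply: eq_bigr => a _; case Sa : (S a); congr nat_of_bool; apply/asboolP.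
  have [x [xz xc]] := tgen_ex p_prime a; exists x; split=> //.
  - split=> [j _|j nSj]; first exact: xz.
    by rewrite xc; case: eqP nSj => // ->; rewrite Sa.
  - by move=> j ltja; rewrite xc ltn_eqF.
  - by rewrite xc eqxx oner_eq0.
by move=> [x [[_ xS] _ _]]; rewrite xS ?Sa ?eqxx.
Qed.

Lemma hdim_graded_density (S : pred nat) (l B : R) :
    (forall k, (0 < k)%N -> `|l - (\sum_(a < k) S a)%:R / (k + k)%:R| <= B / k%:R) ->
  closed_subgroup (graded_set predT S) /\ hdim R p (graded_set predT S) = l.
Proof.
move=> rate; have Ksub : subgroup (graded_set predT S).
  apply: (@subgroup_graded_set _ _ 0%N 0%N) => [a|x xZ k _]; first by rewrite addn0.
  by exists 0%N; rewrite /twist xZ.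
split; first by split=> //; exact: closed_graded_set.
apply/cvg_hdim/(hdim_quotient_rate (B := B) (N := 0%N)) => // k k_gt0.
rewrite tjumps_graded_set /zjumps big1 ?add0n => [|i _]; first exact: rate.
by case: asboolP => // -[x [[xZ _] _]]; rewrite xZ.
Qed.

(** Take S with counting function t(k) = floor(2xk). Its increments are 0 or 1 because 2x <= 1, and
    t(k)/(2k) tends to x. *)
Lemma hspec_small (x : R) : 0 <= x <= 1 / 2 -> hspec R (W p) p x.
Proof.
move=> /andP[x_ge0 x_le]; pose t k := Num.truncn (2 * x * k%:R).
have tP k : (t k)%:R <= 2 * x * k%:R < (t k).+1%:R.
  by apply: truncn_itv; rewrite !mulr_ge0.
pose S a := (t a < t a.+1)%N.
have tS a : t a.+1 = (t a + S a)%N.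
  have /andP[l1 l2] := tP a; have /andP[l3 l4] := tP a.+1.
  have le1 : (t a < (t a.+1).+1)%N.
    rewrite -(ltr_nat R) (le_lt_trans l1) // (le_lt_trans _ l4) //.
    by rewrite ler_wpM2l ?ler_nat ?mulr_ge0.
  have le2 : (t a.+1 < (t a).+2)%N.
    rewrite -(ltr_nat R) (le_lt_trans l3) //.
    by rewrite -[a.+1]addn1 -[(t a).+2]addn1 !natrD mulrDr; lra.
  by rewrite /S; case: ltnP; lia.
have sumS k : (\sum_(a < k) S a = t k)%N.
  elim: k => [|k IHk]; last by rewrite big_ord_recr /= IHk tS.
  rewrite big_ord0; apply/esym/eqP; rewrite -leqn0 -(ler_nat R).
  by have /andP[] := tP 0%N; rewrite mulr0.
have [|cK hK] := @hdim_graded_density S x 1; last by exists (graded_set predT S).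
move=> k k_gt0; rewrite sumS; have /andP[] := tP k; rewrite -[(t k).+1]addn1 !natrD.
have : 0 < k%:R :> R by rewrite ltr0n.
move: (k%:R) ((t k)%:R) => r tk k0 l1 l2.
have -> : x - tk / (r + r) = (2 * x * r - tk) / (2 * r).
  by field; rewrite gt_eqF //; lra.
rewrite ger0_norm; last by rewrite divr_ge0 ?subr_ge0 // mulr_ge0 // ltW.
rewrite ler_pdivrMr ?mulr_gt0 // (_ : 1 / r * (2 * r) = 2); first by lra.
by rewrite mul1r mulrC mulfK // gt_eqF.
Qed.

(** Realized by the Z_p parts in p^n Z_p with power series supported on the residues 0, ..., m - 1
    modulo p^n. *)
Lemma hspec_large (n m : nat) : (m <= p ^ n)%N ->
  hspec R (W p) p (1 / 2 + m%:R / (2 * p%:R ^+ n)).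
Proof.
move=> le_m; pose K := graded_set (pred1 n) (fun a => (a %% p ^ n < m)%N).
have Ksub : subgroup K.
  apply: (@subgroup_graded_set _ _ (p ^ n) n) => [a|x xZ k le_nk].
    by rewrite modnDr.
  have /dvdnP[u xu] : (p ^ n %| zpart x k)%N by rewrite zpart_dvd // xZ //= eqxx.
  by exists u; rewrite /twist xu mulnC exprM polyXD1_expp.
exists K; first by split=> //; exact: closed_graded_set.
(* With Q = p^n, the incomplete period leaves the discrepancy Q min(m, r) - m r, both terms being at
   most Q^2. *)
apply: cvg_hdim; apply: (@hdim_quotient_linear K n m (p ^ n * p ^ n)) => // k lt_nk.
split.
  apply: zjumpsE => // [|i [x [[xZ _] _ xi]]].
    have [x [xz xc]] := zgen_ex p_prime n; exists x; split.
    - by split=> [j /eqP->|a _]; rewrite ?xz ?modnn ?xc.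
    - by rewrite xz modnn.
    - by rewrite xz modn_small ?ltn_exp2l // -lt0n.
  rewrite leqNgt; apply: contraNN xi => lt_in.
  by apply/eqP; apply: (zpart_anti p_prime lt_in); rewrite xZ //= eqxx.
rewrite tjumps_graded_set sum_modn_lt //.
have := pk_gt0 n; move: (p ^ n)%N le_m => Q le_m Q0.
have := ltn_pmod k Q0; have := divn_eq k Q.
move: (k %/ Q)%N (k %% Q)%N => q r -> ltrQ.
have : (minn m r <= Q)%N by rewrite geq_min le_m.
move: (minn m r) => c lec.
have : (Q * c <= Q * Q)%N by rewrite leq_mul2l lec orbT.
have : (m * r <= Q * Q)%N by rewrite leq_mul // ltnW.
by rewrite !mulnDr (mulnCA Q m q) (mulnC q Q); split; lia.
Qed.

Lemma hdim_cases K : subgroup K ->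
  0 <= hdim R p K <= 1 / 2 \/
  exists n m, [/\ (m <= p ^ n)%N, hdim R p K = 1 / 2 + m%:R / (2 * p%:R ^+ n)
                & strong_hdim R p K].
Proof.
move=> Ksub; have [Kz|nKz] := pselect (exists i, zjump K i); last first.
  by left; apply: hdim_base => // i Ki; apply: nKz; exists i.
right; have exz : exists i, `[< zjump K i >] by case: Kz => i Ki; exists i; apply/asboolP.
case: (ex_minnP exz) => n /asboolP Kn n_min.
have [i Ki|m [C [le_m asym]]] := jumps_asymptotics p_prime Ksub Kn.
  by apply: n_min; apply/asboolP.
have cvgK := hdim_quotient_linear Ksub asym.
by exists n, m; rewrite /strong_hdim (cvg_hdim cvgK).
Qed.
End Spectrum.

Theorem corollary2p11 (R : realType) (p : nat) (p_prime : prime p)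
    (p_odd : odd p) :
  hspec R (W p) p =
    [set x : R | 0 <= x <= 1 / 2] `|`
    [set x : R | exists n m : nat, (1 <= m <= p ^ n - 1)%N /\
       x = 1 / 2 + m%:R / (2 * p%:R ^+ n)] `|`
    [set 1]
  /\
  forall K : set (W p), closed_subgroup K ->
    1 / 2 < hdim R p K -> strong_hdim R p K.
Proof.
split; last first.
  move=> K [Ksub _] lt_K; case: (hdim_cases R p_prime Ksub) => [/andP[_ le_K]|].
    by rewrite ltNge le_K in lt_K.
  by case=> n [m []].
apply/seteqP; split.
  move=> _ [K [Ksub _] <-].
  case: (hdim_cases R p_prime Ksub) => [hK|[n [m [le_m -> _]]]]; first by left; left.
  have pn_gt0 : (0 < p ^ n)%N by rewrite expn_gt0 prime_gt0.
  (* The extreme values m = 0 and m = p^n give 1/2, in the interval, and 1. *)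
  have [->|m_gt0] := posnP m.
    by left; left => /=; rewrite mul0r addr0 divr_ge0 //= lexx.
  have [lt_m|ge_m] := ltnP m (p ^ n); first by left; right; exists n, m; split=> //; lia.
  right => /=; rewrite (_ : m = p ^ n)%N; last by apply/eqP; rewrite eqn_leq le_m.
  rewrite natrX; have : p%:R ^+ n != 0 :> R by rewrite -natrX pnatr_eq0 -lt0n.
  by move=> ?; field.
move=> x [[x_small|[n [m [/andP[_ le_m] ->]]]]|->]; first exact: hspec_small.
  by apply: hspec_large => //; apply: (leq_trans le_m); exact: leq_subr.
(* The value 1 is the case n = 0, m = 1. *)
have -> : 1 = 1 / 2 + 1%:R / (2 * p%:R ^+ 0) :> R by rewrite expr0; field.
exact: hspec_large.
Qed.
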